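(* Let $\nu$ be a computable probability measure on Cantor space $2^{\mathbb{N}}$ with full support. Then $\mathsf{MLR}^{\nu}=\mathsf{MR}^{\nu}_2(\ll_{\mathsf{MLR}}, \mathscr{F}_{n+1},H)$.
   Context: A probability measure $\nu$ on Cantor space is identified with the function $\sigma\mapsto\nu(\sigma):=\nu([\sigma])$ on $2^{<\mathbb{N}}$, where $[\sigma]$ is the set of $\omega\in 2^{\mathbb{N}}$ extending $\sigma$. It is computable if the reals $\nu(\sigma)$ are computable uniformly in $\sigma$; it has full support if $\nu(\sigma)>0$ for all $\sigma$. $\omega\upharpoonright n$ is the length-$n$ initial segment of $\omega$. $\mathscr{F}_n$ is the $\sigma$-algebra generated by the sets $[\sigma]$ with $|\sigma|=n$. Hellinger distance: for probability measures $P\ll Q$ on a $\sigma$-algebra, $H(P,Q)=\big(2(1-\mathbb{E}_Q[(\frac{dP}{dQ})^{1/2}])\big)^{1/2}$. For $\nu,\mu$ with full support, $H_{\mathscr{F}_{n+1}}(\nu,\mu)(\omega)$ denotes $H(P,Q)$ where $P,Q$ are the restrictions to $\mathscr{F}_{n+1}$ of the conditional measures $\nu(\cdot\mid[\omega\upharpoonright n])$ and $\mu(\cdot\mid[\omega\upharpoonright n])$, respectively. A c.e. open set is one of the form $\bigcup_n[\sigma_n]$ for a computable sequence $\sigma_n$ of binary strings. $\mathsf{MLR}^{\nu}$ (Martin-Löf $\nu$-random points) is the set of $\omega$ such that $\omega\notin\bigcap_n U_n$ for every computable sequence $U_n$ of c.e. opens with $\nu(U_n)\le 2^{-n}$ for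 all $n\ge 0$. $\nu\ll_{\mathsf{MLR}}\mu$ means $\mathsf{MLR}^{\nu}\subseteq\mathsf{MLR}^{\mu}$. $\mathsf{MR}^{\nu}_2(\ll_{\mathsf{MLR}},\mathscr{F}_{n+1},H)$ is the set of $\omega\in2^{\mathbb{N}}$ such that for all computable probability measures $\mu$ with full support and $\nu\ll_{\mathsf{MLR}}\mu$, one has $\sum_n \big(H_{\mathscr{F}_{n+1}}(\nu,\mu)(\omega)\big)^2<\infty$. *)

(* Defs.v *)
From HB Require Import structures.
From mathcomp Require Import all_boot all_order all_algebra.
From mathcomp Require Import all_classical all_reals all_analysis.

Set Implicit Arguments.
Unset Strict Implicit.
Unset Printing Implicit Defensive.
Import Order.TTheory GRing.Theory Num.Theory.

Local Open Scope classical_set_scope.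
Local Open Scope ring_scope.

(* Total computable functions on nat, as Kleene's general recursive functions:
   minimization is applied only where it always terminates, so that every
   function in the class is total. *)
Inductive recursive : forall k : nat, (k.-tuple nat -> nat) -> Prop :=
| recursive_zero : @recursive 0 (fun _ => 0%N)
| recursive_succ : @recursive 1 (fun x => (thead x).+1)
| recursive_proj k (i : 'I_k) : @recursive k (fun x => tnth x i)
| recursive_comp k m (g : m.-tuple nat -> nat)
    (h : 'I_m -> k.-tuple nat -> nat) :
    recursive g -> (forall i, recursive (h i)) ->
    @recursive k (fun x => g [tuple h i x | i < m])
| recursive_prim k (f : k.-tuple nat -> nat) (g : k.+2.-tuple nat -> nat) :
    recursive f -> recursive g ->
    @recursive k.+1 (fun x =>
      iteri (thead x) (fun m r => g [tuple of m :: r :: behead x])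
        (f [tuple of behead x]))
| recursive_mu k (f : k.+1.-tuple nat -> nat)
    (f0 : forall x : k.-tuple nat, exists m, f [tuple of m :: x] == 0%N) :
    recursive f -> @recursive k (fun x => ex_minn (f0 x)).

Definition recursive2 (f : nat -> nat -> nat) : Prop :=
  @recursive 2 (fun x => f [tnth x 0] [tnth x 1]).

(* Bijective base-2 numeration, least significant digit first, with the digits
   1 and 2 standing for false and true. *)
Definition string_code (s : seq bool) : nat :=
  foldr (fun (b : bool) (n : nat) => n.*2 + b.+1)%N 0%N s.

Lemma string_code_inj : injective string_code.
Proof.
have E (b : bool) n : (n.*2 + b.+1 = (b + n.*2).+1)%N by rewrite addnC.
elim=> [|b s IH] [|c t] //=; rewrite ?E // => -[e].
have bc : b = c.
  by move/(congr1 odd): e; rewrite !oddD !odd_double !addbF !oddb.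
by rewrite bc in e *; move/addnI/double_inj/IH: e => ->.
Qed.

Lemma string_code_surj n : exists s, string_code s = n.
Proof.
have [m] := ubnP n; elim: m n => // m IH [|n] lenm; first by exists [::].
have [|s es] := IH n./2.
  by move: lenm; rewrite ltnS; apply: leq_ltn_trans; rewrite -divn2 leq_div.
exists (odd n :: s) => /=.
by rewrite es addnS addnC odd_double_half.
Qed.

Definition cantor : measurableType (sigma_display (@open cantor_space)) :=
  g_sigma_algebraType (@open cantor_space).
Arguments cantor : simpl never.

Definition cylinder (s : seq bool) : set cantor :=
  [set w : cantor | mkseq w (size s) = s].

Definition cylinders (n : nat) : set (set cantor) :=
  [set cylinder s | s in [set s : seq bool | size s = n]].

Definition sigmaF (n : nat) : measurableType (sigma_display (cylinders n)) :=
  g_sigma_algebraType (cylinders n).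
Arguments sigmaF : simpl never.

Lemma open_cylinder s : open (cylinder s : set cantor_space).
Proof.
have opn n : open [set w : cantor_space |
    forall i, (i < n)%N -> w i = nth false s i].
  elim: n => [|n IH].
    by rewrite (_ : mkset _ = setT); [exact: openT | apply/seteqP; split].
  rewrite (_ : mkset _ = [set w : cantor_space |
      forall i, (i < n)%N -> w i = nth false s i] `&`
    (proj n : cantor_space -> bool) @^-1` [set nth false s n]).
    apply: openI => //; apply: open_comp; last exact: discrete_open.
    by move=> w _; exact: (@proj_continuous _ (fun=> bool)).
  apply/seteqP; split => [w h|w [h wn] i] /=.
    by split => [i /ltnW|]; apply: h.
  by rewrite ltnS leq_eqVlt => /predU1P[->//|]; exact: h.
rewrite (_ : cylinder s = [set w : cantor_space |
    forall i, (i < size s)%N -> w i = nth false s i])//.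
apply/seteqP; split => w /= ws.
  by move=> i si; rewrite -[in RHS]ws nth_mkseq.
apply: (@eq_from_nth _ false); rewrite size_mkseq// => i si.
by rewrite nth_mkseq// ws.
Qed.

Lemma measurable_cylinder s : measurable (cylinder s).
Proof. by apply: sub_sigma_algebra; exact: open_cylinder. Qed.

Definition to_sigmaF (n : nat) (w : cantor) : sigmaF n := w.

Lemma measurable_to_sigmaF n : measurable_fun setT (to_sigmaF n).
Proof.
apply: (@measurability _ _ cantor (sigmaF n) setT (to_sigmaF n) (cylinders n))
  => // _ [_ [s _ <-] <-].
by rewrite setTI; exact: measurable_cylinder.
Qed.

HB.instance Definition _ n := isMeasurableFun.Build _ _ _ _
  (to_sigmaF n) (@measurable_to_sigmaF n).

Section measures.
Variable R : realType.
Implicit Types (nu mu : probability cantor R) (s : seq bool) (w : cantor).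

(* Fast convergence of rational approximations (a - b) / (c + 1). *)
Definition computable_measure nu : Prop :=
  exists a b c : nat -> nat -> nat,
    [/\ recursive2 a, recursive2 b, recursive2 c &
     forall s k,
       `| fine (nu (cylinder s)) -
          ((a (string_code s) k)%:R - (b (string_code s) k)%:R) /
          (c (string_code s) k).+1%:R |
       <= 2^-1 ^+ k].

Definition full_support nu : Prop := forall s, (0 < nu (cylinder s))%E.

Definition computable_seq_ce_open (U : nat -> set cantor) : Prop :=
  exists s : nat -> nat -> seq bool,
    recursive2 (fun n m => string_code (s n m)) /\
    forall n, U n = \bigcup_m cylinder (s n m).

Definition MLR nu : set cantor :=
  [set w | forall U : nat -> set cantor,
     computable_seq_ce_open U ->
     (forall n, (nu (U n) <= (2^-1 ^+ n)%:E)%E) ->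
     ~ (\bigcap_n U n) w].

Definition MLR_dominated nu mu : Prop := MLR nu `<=` MLR mu.

(* mnormalize resorts to its last argument only if nu (cylinder s) = 0. *)
Definition conditional nu s : probability cantor R :=
  mnormalize (mrestr nu (measurable_cylinder s)) nu.

Definition restriction (n : nat) nu : probability (sigmaF n) R :=
  distribution nu (to_sigmaF n).

(* To be used for P `<< Q only. *)
Definition hellinger d (T : measurableType d) (P Q : probability T R) : R :=
  Num.sqrt (2 * (1 - fine 'E_Q[fun x =>
    Num.sqrt (fine (Radon_Nikodym (charge_of_finite_measure P) Q x))])).

Definition hellingerF (n : nat) nu mu w : R :=
  hellinger (restriction n.+1 (conditional nu (mkseq w n)))
            (restriction n.+1 (conditional mu (mkseq w n))).

Definition MR2 nu : set cantor :=
  [set w | forall mu : probability cantor R,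
     computable_measure mu -> full_support mu -> MLR_dominated nu mu ->
     (\sum_(0 <= n <oo) ((hellingerF n nu mu w) ^+ 2)%:E < +oo)%E].

End measures.

(* Main.v *)
(* The geometric mean idea, due to Vovk: if [nu] and [mu] are computable with full
   support, let [lambda] be the measure whose conditional probabilities are the
   normalised geometric means of those of [nu] and [mu].  Then
   [lambda ^ 2 / (nu mu)] along [w] is the product of the
   [(1 - H_n ^ 2 / 2) ^ -2], and a point random for both [nu] and [mu] keeps
   [lambda / nu] and [lambda / mu] bounded, whence [\sum_n H_n ^ 2 < oo].  To make
   the test decidable, [nu] and [mu] are replaced by rational-valued measures
   within a factor 2, and [H ^ 2] by the triangular discrimination.

   Conversely, if a test [(U_j)] captures [w], let [mu] have the same (rationally
   approximated) conditional probabilities as [nu], except at the strings where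
   some [U_j] is first seen to be entered; there it is 1/4 for one bit and 3/4 for
   the other.  For one of the two fixed choices of the favoured bit,
   [H_n ^ 2 >= 1/64] infinitely often along [w].  A string with no
   entry into [U_j] for [j >= n] has [nu <= 2 * 4 ^ n * mu], and all other strings
   lie in a set of [nu]-measure at most [2 ^ (1 - n)]; hence a [mu]-test becomes a
   [nu]-test after thinning its levels, so [nu <<_MLR mu]. *)
Require Import Defs.
From HB Require Import structures.
From mathcomp Require Import all_boot all_order all_algebra.
From mathcomp Require Import all_classical all_reals all_analysis measurable_realfun.
From mathcomp Require Import zify ring lra.

Set Implicit Arguments.
Unset Strict Implicit.
Unset Printing Implicit Defensive.
Import Order.TTheory GRing.Theory Num.Theory.

(** * Closure properties of recursive functions *)

Definition tbehead k (x : k.+1.-tuple nat) : k.-tuple nat := [tuple of behead x].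

Lemma tbehead_cons k n (x : k.-tuple nat) : tbehead [tuple of n :: x] = x.
Proof. exact: val_inj. Qed.

Lemma tnth_tbehead k (x : k.+1.-tuple nat) i :
  tnth (tbehead x) i = tnth x (lift ord0 i).
Proof. by rewrite (tnth_nth 0) nth_behead (tnth_nth 0). Qed.

Lemma eq_recursive k (f g : k.-tuple nat -> nat) :
  f =1 g -> recursive f -> recursive g.
Proof. by move=> fg; rewrite (funext fg). Qed.

Lemma recursive_const k n : @recursive k (fun=> n).
Proof.
elim: n => [|n IH].
  have r0 (i : 'I_0) : recursive (fun _ : k.-tuple nat => 0) by case: i.
  exact: recursive_comp recursive_zero r0.
apply: eq_recursive (recursive_comp recursive_succ (fun i : 'I_1 => IH)) => x.
by rewrite /thead tnth_mktuple.
Qed.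

Lemma recursive_comp1 k (g : nat -> nat) (f : k.-tuple nat -> nat) :
  @recursive 1 (fun x => g (thead x)) -> recursive f ->
  recursive (fun x => g (f x)).
Proof.
move=> rg rf; apply: eq_recursive (recursive_comp rg (fun i : 'I_1 => rf)) => x.
by rewrite /thead tnth_mktuple.
Qed.

Lemma recursive_comp2 k (g : nat -> nat -> nat) (f1 f2 : k.-tuple nat -> nat) :
  recursive2 g -> recursive f1 -> recursive f2 ->
  recursive (fun x => g (f1 x) (f2 x)).
Proof.
move=> rg r1 r2.
have rh (i : 'I_2) : recursive (if val i == 0 then f1 else f2).
  by case: ifP.
apply: eq_recursive (recursive_comp rg rh) => x.
by rewrite !tnth_mktuple.
Qed.

Lemma recursive_fst : recursive2 (fun m _ => m).
Proof.
by apply: eq_recursive (recursive_proj ord0) => x; congr tnth; exact: val_inj.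
Qed.

Lemma recursive_snd : recursive2 (fun _ n => n).
Proof.
by apply: eq_recursive (recursive_proj ord_max) => x; congr tnth; exact: val_inj.
Qed.

Lemma recursive_S k (f : k.-tuple nat -> nat) :
  recursive f -> recursive (fun x => (f x).+1).
Proof. exact: (recursive_comp1 recursive_succ). Qed.

Lemma recursive_thead k : @recursive k.+1 (fun x => thead x).
Proof. exact: recursive_proj. Qed.

Lemma recursive_tbehead k (f : k.-tuple nat -> nat) :
  recursive f -> @recursive k.+1 (fun x => f (tbehead x)).
Proof.
move=> rf.
apply: eq_recursive (recursive_comp rf
  (fun i => @recursive_proj k.+1 (lift ord0 i))) => x.
congr f; apply: eq_from_tnth => i.
by rewrite tnth_mktuple tnth_tbehead.
Qed.

Lemma recursive_cons k (f : k.+1.-tuple nat -> nat) (n : k.-tuple nat -> nat) :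
  recursive f -> recursive n -> recursive (fun x => f [tuple of n x :: x]).
Proof.
move=> rf rn.
have rh (i : 'I_k.+1) : recursive (fun x : k.-tuple nat =>
    if unlift ord0 i is Some j then tnth x j else n x).
  by case: unliftP => [j|] _; [exact: recursive_proj|].
apply: eq_recursive (recursive_comp rf rh) => x.
congr f; apply: eq_from_tnth => i; rewrite tnth_mktuple.
by case: unliftP => [j|] -> //; rewrite !(tnth_nth 0).
Qed.

Lemma recursive_iteri k (n f : k.-tuple nat -> nat)
    (g : nat -> nat -> k.-tuple nat -> nat) :
  recursive n -> recursive f ->
  @recursive k.+2 (fun y =>
    g (thead y) (thead (tbehead y)) (tbehead (tbehead y))) ->
  recursive (fun x => iteri (n x) (fun m r => g m r x) (f x)).
Proof.
move=> rn rf rg.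
have := recursive_cons (recursive_prim rf rg) rn.
apply: eq_recursive => x.
rewrite -/(tbehead _) tbehead_cons theadE.
apply: eq_iteri => m r; congr (g _ _ _); exact: val_inj.
Qed.

Lemma recursive_add k (f g : k.-tuple nat -> nat) :
  recursive f -> recursive g -> recursive (fun x => f x + g x).
Proof.
move=> rf rg; have := recursive_iteri (g := fun _ r _ => r.+1) rg rf
  (recursive_S (recursive_tbehead (recursive_thead _))).
by apply: eq_recursive => x; elim: (g x) => [|m /= ->]; rewrite ?addn0 ?addnS.
Qed.

Section arithmetic.
Variable k : nat.
Implicit Types (f g : k.-tuple nat -> nat) (b c : k.-tuple nat -> bool).

Lemma recursive_mul f g :
  recursive f -> recursive g -> recursive (fun x => f x * g x).
Proof.
move=> rf rg.
have := recursive_iteri (g := fun _ r x => f x + r) rg (recursive_const _ 0)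
  (recursive_add (recursive_tbehead (recursive_tbehead rf))
     (recursive_tbehead (recursive_thead _))).
by apply: eq_recursive => x; elim: (g x) => [|m /= ->]; rewrite ?muln0 ?mulnS.
Qed.

Lemma recursive_sub f g :
  recursive f -> recursive g -> recursive (fun x => f x - g x).
Proof.
move=> rf rg.
have rpred : @recursive 1 (fun x => (thead x).-1).
  have := recursive_iteri (g := fun m _ _ => m) (recursive_thead 0)
    (recursive_const _ 0) (recursive_thead _).
  by apply: eq_recursive => x; case: (thead x).
have := recursive_iteri (g := fun _ r _ => r.-1) rg rf
  (recursive_comp1 rpred (recursive_tbehead (recursive_thead _))).
by apply: eq_recursive => x; elim: (g x) => [|m /= ->]; rewrite ?subn0 ?subnS.
Qed.

Lemma recursive_leq f g :
  recursive f -> recursive g -> recursive (fun x => f x <= g x : nat).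
Proof.
move=> rf rg.
apply: eq_recursive (recursive_sub (recursive_const _ 1) (recursive_sub rf rg)).
by move=> x; rewrite -subn_eq0; case: (f x - g x).
Qed.

Lemma recursive_ltn f g :
  recursive f -> recursive g -> recursive (fun x => f x < g x : nat).
Proof. by move=> rf; exact: recursive_leq (recursive_S rf). Qed.

Lemma recursive_and b c :
  recursive (fun x => b x : nat) -> recursive (fun x => c x : nat) ->
  recursive (fun x => b x && c x : nat).
Proof.
move=> rb rc; apply: eq_recursive (recursive_mul rb rc) => x.
by rewrite mulnb.
Qed.

Lemma recursive_neg b :
  recursive (fun x => b x : nat) -> recursive (fun x => ~~ b x : nat).
Proof.
move=> rb; apply: eq_recursive (recursive_sub (recursive_const _ 1) rb) => x.
by case: (b x).
Qed.

Lemma recursive_or b c :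
  recursive (fun x => b x : nat) -> recursive (fun x => c x : nat) ->
  recursive (fun x => b x || c x : nat).
Proof.
move=> rb rc.
apply: eq_recursive (recursive_neg (recursive_and (recursive_neg rb)
  (recursive_neg rc))) => x.
by rewrite negb_and !negbK.
Qed.

Lemma recursive_eq f g :
  recursive f -> recursive g -> recursive (fun x => f x == g x : nat).
Proof.
move=> rf rg.
apply: eq_recursive (recursive_and (recursive_leq rf rg) (recursive_leq rg rf)).
by move=> x; rewrite eqn_leq.
Qed.

Lemma recursive_if b f g :
  recursive (fun x => b x : nat) -> recursive f -> recursive g ->
  recursive (fun x => if b x then f x else g x).
Proof.
move=> rb rf rg.
apply: eq_recursive (recursive_add (recursive_mul rb rf)
  (recursive_mul (recursive_neg rb) rg)) => x.
by case: (b x); rewrite ?mul1n ?mul0n ?addn0.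
Qed.

End arithmetic.

Section iterated.
Variables (k : nat) (n : k.-tuple nat -> nat) (rn : recursive n).

Let rF2 (f : nat -> k.-tuple nat -> nat) :
  @recursive k.+1 (fun y => f (thead y) (tbehead y)) ->
  @recursive k.+2 (fun y => f (thead y) (tbehead (tbehead y))).
Proof.
move=> rf.
pose h (i : 'I_k.+1) (y : k.+2.-tuple nat) :=
  if unlift ord0 i is Some j then tnth y (lift ord0 (lift ord0 j)) else thead y.
have rh i : recursive (h i).
  by rewrite /h; case: unliftP => [j|] _; exact: recursive_proj.
apply: eq_recursive (recursive_comp rf rh) => y.
congr f; first by rewrite /thead tnth_mktuple /h unlift_none.
by apply: eq_from_tnth => i; rewrite !tnth_tbehead tnth_mktuple /h liftK.
Qed.

Lemma recursive_sum (f : nat -> k.-tuple nat -> nat) :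
  @recursive k.+1 (fun y => f (thead y) (tbehead y)) ->
  recursive (fun x => \sum_(i < n x) f i x).
Proof.
move=> /rF2 rf.
have := recursive_iteri (g := fun m r x => r + f m x) rn (recursive_const _ 0)
  (recursive_add (recursive_tbehead (recursive_thead _)) rf).
apply: eq_recursive => x.
by elim: (n x) => [|m /= ->]; rewrite ?big_ord0 ?big_ord_recr.
Qed.

Lemma recursive_bigprod (f : nat -> k.-tuple nat -> nat) :
  @recursive k.+1 (fun y => f (thead y) (tbehead y)) ->
  recursive (fun x => \prod_(i < n x) f i x).
Proof.
move=> /rF2 rf.
have := recursive_iteri (g := fun m r x => r * f m x) rn (recursive_const _ 1)
  (recursive_mul (recursive_tbehead (recursive_thead _)) rf).
apply: eq_recursive => x.
by elim: (n x) => [|m /= ->]; rewrite ?big_ord0 ?big_ord_recr.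
Qed.

Lemma recursive_exists (b : nat -> k.-tuple nat -> bool) :
  @recursive k.+1 (fun y => b (thead y) (tbehead y) : nat) ->
  recursive (fun x => [exists i : 'I_(n x), b i x] : nat).
Proof.
move=> rb; apply: eq_recursive (recursive_ltn (recursive_const _ 0)
  (recursive_sum (f := fun i x => b i x) rb)) => x.
congr (nat_of_bool _); rewrite lt0n sum_nat_eq0.
rewrite negb_forall; apply: eq_existsb => i.
by case: (b i x).
Qed.

Lemma recursive_expn m : recursive (fun x => m ^ n x).
Proof.
have := recursive_bigprod (recursive_const _ m).
by apply: eq_recursive => x; rewrite big_const_ord iter_muln_1.
Qed.

End iterated.

Lemma sum_ltn m n : m <= n -> \sum_(i < n) (i < m) = m.
Proof.
move=> le; rewrite -(big_mkord xpredT (fun i => i < m : nat)).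
rewrite (big_cat_nat _ le)//= addnC big_nat big1 => [|i /andP[ge _]]; last first.
  by rewrite ltnNge ge.
rewrite add0n big_nat (eq_bigr (fun=> 1)) => [|i /andP[_ ->]//].
by rewrite -big_nat sum_nat_const_nat subn0 muln1.
Qed.

Lemma recursive_divn k (f g : k.-tuple nat -> nat) :
  (forall x, 0 < g x) -> recursive f -> recursive g ->
  recursive (fun x => f x %/ g x).
Proof.
move=> g0 rf rg.
have := recursive_sum rf (f := fun i x => i.+1 * g x <= f x)
  (recursive_leq (recursive_mul (recursive_S (recursive_thead _))
    (recursive_tbehead rg)) (recursive_tbehead rf)).
apply: eq_recursive => x.
under eq_bigr do rewrite -leq_divRL//.
by rewrite sum_ltn// leq_div.
Qed.

Lemma recursive_modn k (f g : k.-tuple nat -> nat) :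
  (forall x, 0 < g x) -> recursive f -> recursive g ->
  recursive (fun x => f x %% g x).
Proof.
move=> g0 rf rg.
apply: eq_recursive (recursive_sub rf (recursive_mul (recursive_divn g0 rf rg) rg)).
by move=> x; rewrite [X in X - _](divn_eq (f x) (g x)) addKn.
Qed.

Lemma recursive_ex_minn k (p : nat -> k.-tuple nat -> bool)
    (p_ex : forall x, exists m, p m x) :
  @recursive k.+1 (fun y => p (thead y) (tbehead y) : nat) ->
  recursive (fun x => ex_minn (p_ex x)).
Proof.
move=> rp.
have f0 (x : k.-tuple nat) : exists m, (fun y : k.+1.-tuple nat =>
    ~~ p (thead y) (tbehead y) : nat) [tuple of m :: x] == 0.
  have [m pm] := p_ex x; exists m; rewrite /= theadE.
  by rewrite tbehead_cons pm.
apply: eq_recursive (recursive_mu f0 (recursive_neg rp)) => x.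
apply: eq_ex_minn => m; rewrite theadE.
by rewrite tbehead_cons eqb0 negbK.
Qed.

Definition string_of (n : nat) : seq bool := sval (cid (string_code_surj n)).

Lemma string_ofK : cancel string_of string_code.
Proof. by move=> n; rewrite /string_of; case: cid. Qed.

Lemma string_codeK : cancel string_code string_of.
Proof. by move=> s; apply: string_code_inj; rewrite string_ofK. Qed.

Lemma string_code_cons b s :
  (string_code (b :: s)).+1 = (string_code s).+1.*2 + b.
Proof. by rewrite /= doubleS addnS addSn. Qed.

(* In binary, [(string_code s).+1] reads as a leading 1 followed by the bits of
   [s], the first bit of [s] being the least significant. *)
Lemma string_code_take s i : i <= size s ->
  (string_code (take i s)).+1 = 2 ^ i + (string_code s).+1 %% 2 ^ i.
Proof.
elim: s i => [|b s IH] [|i]//= si; rewrite ?modn1// -[X in X.+1 = _]/(string_code (b :: take i s)).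
rewrite string_code_cons IH//.
rewrite -[_ + b.+1]/(string_code (b :: s)) string_code_cons.
rewrite expnS mul2n; set c := (string_code s).+1.
have h : c %% 2 ^ i < 2 ^ i by rewrite ltn_pmod// expn_gt0.
have -> : (c.*2 + b) %% (2 ^ i).*2 = (c %% 2 ^ i).*2 + b.
  have -> : c.*2 + b = c %/ 2 ^ i * (2 ^ i).*2 + ((c %% 2 ^ i).*2 + b).
    by rewrite [in LHS](divn_eq c (2 ^ i)) doubleD -doubleMr addnA.
  by rewrite modnMDl modn_small//; move: (c %% _) h => u; case: b; lia.
by rewrite doubleD addnA.
Qed.

Lemma string_code_nth s i : i < size s ->
  nth false s i = odd ((string_code s).+1 %/ 2 ^ i).
Proof.
elim: s i => [|b s IH] [|i]//= si; rewrite -[_ + b.+1]/(string_code (b :: s)) string_code_cons.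
  by rewrite expn0 divn1 oddD odd_double; case: b.
rewrite IH// expnS divnMA; congr (odd (_ %/ _)).
by rewrite divn2 halfD odd_double /= doubleK; case: b; rewrite /= addn0.
Qed.

Lemma string_code_bounds s : 2 ^ size s <= (string_code s).+1 < 2 ^ (size s).+1.
Proof.
elim: s => [|b s IH]//; rewrite string_code_cons /= [2 ^ (size s).+2]expnS [2 ^ _.+1]expnS.
by move: IH; rewrite [2 ^ (size s).+1]expnS; case: b; lia.
Qed.

Lemma size_string s : size s = \sum_(i < string_code s) (2 ^ i.+1 <= (string_code s).+1).
Proof.
have /andP[lo hi] := string_code_bounds s.
have le : size s <= string_code s.
  by rewrite -ltnS (leq_trans _ lo)// ltn_expl.
have E i : (2 ^ i.+1 <= (string_code s).+1) = (i < size s).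
  apply/idP/idP => h; last by rewrite (leq_trans _ lo)// leq_exp2l.
  by have := leq_ltn_trans h hi; rewrite ltn_exp2l.
under eq_bigr do rewrite E.
by rewrite sum_ltn.
Qed.

Lemma string_code_rcons s b :
  string_code (rcons s b) = string_code s + b.+1 * 2 ^ size s.
Proof.
elim: s => [|c s IH] /=; first by rewrite muln1.
by rewrite IH expnS doubleD; lia.
Qed.

Section strings.
Variable k : nat.
Implicit Types (s t : k.-tuple nat -> seq bool) (i : k.-tuple nat -> nat).

Definition recursive_string s := recursive (fun x => string_code (s x)).

Lemma recursive_string_of (i : k.-tuple nat -> nat) :
  recursive i -> recursive_string (fun x => string_of (i x)).
Proof. by apply: eq_recursive => x; rewrite string_ofK. Qed.

Definition recursive_on_strings (f : seq bool -> nat) :=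
  @recursive 1 (fun x => f (string_of (thead x))).

Lemma recursive_string_comp (f : seq bool -> nat) s :
  recursive_on_strings f -> recursive_string s -> recursive (fun x => f (s x)).
Proof.
move=> rf rs; apply: eq_recursive (recursive_comp1 (g := f \o string_of) rf rs) => x.
by rewrite /= string_codeK.
Qed.

Lemma recursive_size s : recursive_string s -> recursive (fun x => size (s x)).
Proof.
move=> rs.
have rle : @recursive k.+1 (fun y =>
    2 ^ (thead y).+1 <= (string_code (s (tbehead y))).+1 : nat).
  by apply: recursive_leq; [exact/recursive_expn/recursive_S/recursive_thead |
    exact/recursive_S/(recursive_tbehead rs)].
apply: eq_recursive (recursive_sum rs (f := fun j x =>
  2 ^ j.+1 <= (string_code (s x)).+1 : nat) rle) => x.
by rewrite -size_string.
Qed.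

Lemma recursive_take s i :
  recursive_string s -> recursive i -> recursive_string (fun x => take (i x) (s x)).
Proof.
move=> rs ri; have r2 : recursive (fun x => 2 ^ i x) by exact: recursive_expn.
apply: eq_recursive (recursive_if (recursive_leq ri (recursive_size rs))
  (recursive_sub (recursive_add r2 (recursive_modn _ (recursive_S rs) r2))
    (recursive_const _ 1)) rs) => x; last by rewrite expn_gt0.
case: ifPn => [/string_code_take <-|]; first by rewrite subn1.
by rewrite -ltnNge => /ltnW; rewrite /= => /take_oversize ->.
Qed.

Lemma recursive_nth s i : recursive_string s -> recursive i ->
  recursive (fun x => nth false (s x) (i x) : nat).
Proof.
move=> rs ri; have r2 : recursive (fun x => 2 ^ i x) by exact: recursive_expn.
apply: eq_recursive (recursive_and (recursive_ltn ri (recursive_size rs))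
  (b := fun x => i x < size (s x))
  (c := fun x => 0 < ((string_code (s x)).+1 %/ 2 ^ i x) %% 2) _) => [x|].
  rewrite modn2 lt0b; case: ltnP => [/string_code_nth ->//|h].
  by rewrite nth_default.
apply: recursive_ltn; first exact: recursive_const.
apply: recursive_modn => //; last exact: recursive_const.
by apply: recursive_divn r2 => [x|]; [rewrite expn_gt0|exact: recursive_S].
Qed.

Lemma recursive_rcons s b :
  recursive_string s -> recursive_string (fun x => rcons (s x) b).
Proof.
move=> rs; apply: eq_recursive (recursive_add rs (recursive_mul
  (recursive_const _ b.+1) (recursive_expn (recursive_size rs) 2))) => x.
by rewrite string_code_rcons.
Qed.

Lemma recursive_prefix s t : recursive_string s -> recursive_string t ->
  recursive (fun x => prefix (s x) (t x) : nat).
Proof.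
move=> rs rt; apply: eq_recursive (recursive_eq rs (recursive_take rt
  (recursive_size rs))) => x.
by rewrite prefixE (inj_eq string_code_inj) eq_sym.
Qed.

End strings.

Local Open Scope classical_set_scope.
Local Open Scope ring_scope.

(** * Cylinders *)

Lemma take_mkseq T (w : nat -> T) i n : (i <= n)%N ->
  take i (mkseq w n) = mkseq w i.
Proof. by move=> le; rewrite -map_take take_iota (minn_idPl le). Qed.

Lemma mkseqS_rcons T (w : nat -> T) n : mkseq w n.+1 = rcons (mkseq w n) (w n).
Proof. by rewrite /mkseq -addn1 iotaD map_cat /= cats1. Qed.

Lemma cylinder_mkseq (w : cantor) n : cylinder (mkseq w n) w.
Proof. by rewrite /cylinder /= size_mkseq. Qed.

Lemma cylinder_nil : cylinder [::] = setT.
Proof. by apply/seteqP. Qed.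

Lemma cylinder_prefix (w : cantor) s n : cylinder s w -> (size s <= n)%N ->
  prefix s (mkseq w n).
Proof. by rewrite prefixE /cylinder /= => ws le; rewrite take_mkseq ?ws. Qed.

Lemma sub_cylinder s t : prefix s t -> cylinder t `<=` cylinder s.
Proof.
rewrite prefixE => /eqP st w wt; rewrite /cylinder /=.
by rewrite -{2}st -wt take_mkseq// -{1}st size_take_min geq_minr.
Qed.

Lemma cylinder_total (w : cantor) s t : cylinder s w -> cylinder t w ->
  prefix s t || prefix t s.
Proof.
move=> ws wt; case/orP: (leq_total (size s) (size t)) => le.
  by rewrite -[t in prefix s t]wt cylinder_prefix.
by rewrite -[s in prefix t s]ws cylinder_prefix ?orbT.
Qed.

Lemma cylinder_rcons s b : cylinder (rcons s b) =
  cylinder s `&` [set w : cantor | w (size s) = b].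
Proof.
apply/seteqP; split=> w; rewrite /cylinder /= size_rcons mkseqS_rcons.
  by move/rcons_inj => [-> ->].
by case=> -> ->.
Qed.

Lemma cylinder_split s :
  cylinder s = cylinder (rcons s false) `|` cylinder (rcons s true).
Proof.
rewrite !cylinder_rcons -setIUr (_ : _ `|` _ = setT) ?setIT//.
by apply/seteqP; split=> // w _ /=; case: (w _); [right|left].
Qed.

Lemma cylinder_split_disj s :
  cylinder (rcons s false) `&` cylinder (rcons s true) = set0.
Proof.
rewrite !cylinder_rcons; apply/seteqP; split=> // w [[_ /= ->] [_]].
by [].
Qed.

Lemma open_sub_cylinder (U : set cantor_space) (w : cantor_space) :
  open U -> U w -> exists n, cylinder (mkseq w n) `<=` U.
Proof.
move=> oU Uw.
pose F : set_system cantor_space :=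
  [set A | exists n, cylinder (mkseq w n) `<=` A].
have FF : Filter F.
  split; first by exists 0%N.
    have sub k m : (k <= m)%N -> cylinder (mkseq w m) `<=` cylinder (mkseq w k).
      move=> km; apply: sub_cylinder; rewrite cylinder_prefix ?size_mkseq//.
      exact: cylinder_mkseq.
    move=> A B [m mA] [n nB]; exists (maxn m n) => v vmn; split.
      by apply: mA; apply: sub vmn; exact: leq_maxl.
    by apply: nB; apply: sub vmn; exact: leq_maxr.
  by move=> A B AB [n nA]; exists n; exact: subset_trans AB.
have : F --> w.
  apply/cvg_sup => i; apply/cvg_image.
    by apply/seteqP; split=> // b _; exists (fun=> b).
  move=> A /= Ab.
  exists ((fun v : cantor_space => v i) @^-1` A); last first.
    apply/seteqP; split=> [b [v Av <-//]|b bA]; by exists (fun=> b).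
  exists i.+1 => v vi /=.
  have -> : v i = w i.
    have : mkseq v (size (mkseq w i.+1)) = mkseq w i.+1 by [].
    rewrite size_mkseq => /(congr1 (nth false ^~ i)).
    by rewrite !nth_mkseq.
  exact: nbhs_singleton Ab.
by move=> /(_ U); apply; exact: open_nbhs_nbhs.
Qed.

Lemma measurable_fun_cantor d (T : measurableType d) (f : T -> cantor) :
  (forall s, measurable (f @^-1` cylinder s)) -> measurable_fun setT f.
Proof.
move=> mf; apply: (@measurability _ _ T cantor setT f (@open cantor_space)) => //.
move=> _ [U oU <-]; rewrite setTI.
rewrite (_ : f @^-1` U = \bigcup_n
    (if asbool (cylinder (string_of n) `<=` U) then f @^-1` cylinder (string_of n) else set0)).
  by apply: bigcup_measurable => n _; case: ifP.
apply/seteqP; split=> x.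
  move=> Ux; have [n nU] := open_sub_cylinder oU Ux.
  exists (string_code (mkseq (f x) n)) => //; rewrite string_codeK ifT; last exact/asboolP.
  exact: cylinder_mkseq.
by case=> n _; case: ifPn => // /asboolP sU /sU.
Qed.

Lemma measurable_bigcup_cylinder I (D : set I) (f : I -> seq bool) :
  measurable (\bigcup_(i in D) cylinder (f i)).
Proof.
apply: sub_sigma_algebra; apply: (@bigcup_open cantor_space) => i _.
exact: open_cylinder.
Qed.

Section cylinder_measure.
Variables (R : realType).
Implicit Types nu mu : probability cantor R.

Lemma cylinder_measure_rcons nu s : (nu (cylinder s) =
  nu (cylinder (rcons s false)) + nu (cylinder (rcons s true)))%E.
Proof.
rewrite [in LHS]cylinder_split measureU ?cylinder_split_disj//; exact: measurable_cylinder.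
Qed.

Lemma cylinder_fin_num nu s : nu (cylinder s) \is a fin_num.
Proof. by apply: fin_num_measure; exact: measurable_cylinder. Qed.

(* The minimal elements of [B] index a partition of the union. *)
Lemma measure_cylinders_le nu mu (K : R) (B : set (seq bool)) : 0 <= K ->
  (forall s, B s -> nu (cylinder s) <= K%:E * mu (cylinder s))%E ->
  (nu (\bigcup_(s in B) cylinder s) <= K%:E * mu (\bigcup_(s in B) cylinder s))%E.
Proof.
move=> K0 BK.
pose M := [set s | B s /\ forall t, B t -> prefix t s -> t = s].
pose F n := if asbool (M (string_of n)) then cylinder (string_of n) else set0.
have mF n : measurable (F n).
  by rewrite /F; case: ifP => // _; exact: measurable_cylinder.
have BF : \bigcup_(s in B) cylinder s = \bigcup_n F n.
  apply/seteqP; split=> w.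
    case=> s Bs ws.
    have ex : exists n, `[< B (mkseq w n) >].
      by exists (size s); apply/asboolP; rewrite ws.
    exists (string_code (mkseq w (ex_minn ex))) => //.
    rewrite /F string_codeK ifT; first exact: cylinder_mkseq.
    case: ex_minnP => n /asboolP Bn mn; apply/asboolP; split=> // t Bt tn.
    have wt : cylinder t w by apply: sub_cylinder tn _ _; exact: cylinder_mkseq.
    have := size_prefix tn; rewrite size_mkseq => le.
    have : (n <= size t)%N by apply: mn; apply/asboolP; rewrite wt.
    by move=> ge; have -> : n = size t by apply/eqP; rewrite eqn_leq le ge.
  case=> n _; rewrite /F; case: ifPn => // /asboolP [Bn _] wn.
  by exists (string_of n).
have tF : trivIset setT F.
  apply/trivIsetP => i j _ _ ij; apply/seteqP; split => // w [].
  rewrite /F; case: ifPn => // /asboolP [Bi mi] wi; case: ifPn => // /asboolP [Bj mj] wj.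
  move/eqP: ij; apply; rewrite -(string_ofK i) -(string_ofK j); congr string_code.
  by case/orP: (cylinder_total wi wj) => [/mj ->|/mi ->].
rewrite BF !measure_bigcup//= -nneseriesZl//.
apply: lee_nneseries => n _; first by rewrite measure_ge0.
rewrite /F; case: ifPn => [/asboolP [Bn _]|_]; first exact: BK.
by rewrite !measure0 mule0.
Qed.

End cylinder_measure.

(** * Measures with prescribed values on cylinders *)

Section extension.
Variables (R : realType) (m : seq bool -> R).
Hypothesis m_nil : m [::] = 1.
Hypothesis m_ge0 : forall s, 0 <= m s.
Hypothesis m_rcons : forall s, m s = m (rcons s false) + m (rcons s true).

(* The unit interval is cut into intervals [[left_end s, left_end s + m s[],
   ordered lexicographically. *)
Let left_end (s : seq bool) : R :=
  \sum_(i < size s) (if nth false s i then m (rcons (take i s) false) else 0).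

Let left_end_rcons s b :
  left_end (rcons s b) = left_end s + (if b then m (rcons s false) else 0).
Proof.
rewrite /left_end size_rcons big_ord_recr /= nth_rcons ltnn eqxx.
rewrite -cats1 take_size_cat//; congr (_ + _); apply: eq_bigr => i _.
by rewrite nth_cat ltn_ord take_cat ltn_ord.
Qed.

Let bit (x : R) s := left_end s + m (rcons s false) <= x.

Fixpoint expansion_prefix (x : R) n : seq bool :=
  if n is n'.+1 then
    rcons (expansion_prefix x n') (bit x (expansion_prefix x n'))
  else [::].

Let expansion (x : measurableTypeR R) : cantor :=
  fun n => bit x (expansion_prefix x n).

Let mkseq_expansion x n : mkseq (expansion x) n = expansion_prefix x n.
Proof. by elim: n => // n IH; rewrite mkseqS_rcons IH. Qed.

Let expansion_rcons s b : expansion @^-1` cylinder (rcons s b) =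
  expansion @^-1` cylinder s `&` [set x : R | bit x s = b].
Proof.
rewrite cylinder_rcons preimage_setI; apply/seteqP.
by split => x; rewrite /cylinder /= mkseq_expansion => -[xs <-]; split => //;
  rewrite /expansion xs.
Qed.

Let measurable_expansion : measurable_fun setT expansion.
Proof.
apply: measurable_fun_cantor => s; elim/last_ind: s => [|s b IH].
  by rewrite cylinder_nil preimage_setT.
rewrite expansion_rcons; apply: measurableI => //.
have mge : measurable [set x : measurableTypeR R | bit x s].
  rewrite (_ : mkset _ = `[left_end s + m (rcons s false), +oo[%classic).
    exact: measurable_itv.
  by apply/seteqP; split => x; rewrite /bit /= in_itv /= andbT.
case: b => //.
rewrite (_ : mkset _ = ~` [set x : measurableTypeR R | bit x s]).
  exact: measurableC.
by apply/seteqP; split => x /= => [->//|/negP/negbTE].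
Qed.

Let expansion_itv s : expansion @^-1` cylinder s `&` `[0, 1[%classic =
  `[left_end s, left_end s + m s[%classic.
Proof.
elim/last_ind: s => [|s b IH].
  by rewrite cylinder_nil preimage_setT setTI /left_end big_ord0 m_nil add0r.
rewrite expansion_rcons setIAC IH left_end_rcons.
have m0 := m_ge0 (rcons s false); have m1 := m_ge0 (rcons s true).
apply/seteqP; split => x; rewrite /bit /= !in_itv /= (m_rcons s).
  by case=> /andP[? ?] <-; case: (leP (_ + m (rcons s false))) => ?; apply/andP; split; lra.
case: b => /andP[? ?]; split; try (apply/andP; split; lra).
  by apply/idP; lra.
by apply/negbTE; rewrite -ltNge; lra.
Qed.

Lemma cylinder_extension :
  exists mu : probability cantor R, forall s, mu (cylinder s) = (m s)%:E.
Proof.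
have mI : measurable (`[0, 1[ : set (measurableTypeR R)) by exact: measurable_itv.
pose P := mnormalize (mrestr lebesgue_measure mI) (dirac (0 : measurableTypeR R)).
pose X : {mfun measurableTypeR R >-> cantor} :=
  HB.pack expansion (isMeasurableFun.Build _ _ _ _ _ measurable_expansion).
exists (distribution P X) => s.
rewrite /= /distribution /pushforward /P /mnormalize /=.
rewrite /mrestr setTI lebesgue_measure_itv /= lte01 oppr0 adde0.
rewrite onee_eq0 /= invr1 mule1 expansion_itv lebesgue_measure_itv /= lte_fin.
case: ltP => h; first by rewrite EFinN EFinD addeAC subee ?add0e.
by congr EFin; apply/eqP; rewrite eq_le m_ge0; lra.
Qed.

End extension.

(** * Hellinger distances *)

Lemma sigmaF_saturated n (A : set (sigmaF n)) : measurable A ->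
  forall w v : nat -> bool, mkseq w n = mkseq v n -> A w -> A v.
Proof.
move=> mA; pose G : set (set (sigmaF n)) := [set B : set (sigmaF n) |
  forall w v : nat -> bool, mkseq w n = mkseq v n -> B w -> B v].
suff : <<s cylinders n >> `<=` G by apply; exact: mA.
apply: smallest_sub; last first.
  move=> _ [s sn <-] w v wv; rewrite /cylinder /= sn => <-.
  by rewrite wv.
split => //.
- move=> B GB w v wv [_ Bw]; split => // Bv; apply: Bw.
  exact: GB (esym wv) Bv.
- by move=> F GF w v wv [i _ Fw]; exists i => //; exact: GF wv Fw.
Qed.

Lemma measurable_cylinder_sigmaF n s : size s = n ->
  measurable (cylinder s : set (sigmaF n)).
Proof. by move=> sn; apply: sub_sigma_algebra; exists s. Qed.

Lemma measurable_fun_sigmaF_cst n d (T : measurableType d) (f : sigmaF n -> T) :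
  (forall y : T, measurable [set y]) -> measurable_fun setT f ->
  forall w v : nat -> bool, mkseq w n = mkseq v n -> f w = f v.
Proof.
move=> m1 mf w v wv.
have mA : measurable (f @^-1` [set f w]) by rewrite -[_ @^-1` _]setTI; exact: mf.
by have /esym := sigmaF_saturated mA wv erefl.
Qed.

Section hellinger.
Variables (R : realType).
Implicit Types nu mu : probability cantor R.

Definition cond_prob nu s b : R :=
  fine (nu (cylinder (rcons s b))) / fine (nu (cylinder s)).

Lemma full_support_fine nu s : full_support nu -> 0 < fine (nu (cylinder s)).
Proof.
by move=> fs; apply: fine_gt0; rewrite fs -ge0_fin_numE// cylinder_fin_num.
Qed.

Lemma cond_prob_gt0 nu s b : full_support nu -> 0 < cond_prob nu s b.
Proof. by move=> fs; apply: divr_gt0; exact: full_support_fine. Qed.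

Lemma cond_probD nu s : full_support nu ->
  cond_prob nu s false + cond_prob nu s true = 1.
Proof.
move=> fs; rewrite -mulrDl -fineD ?cylinder_fin_num//.
by rewrite -cylinder_measure_rcons divff// gt_eqF// full_support_fine.
Qed.

Lemma restriction_conditionalE nu n s (A : set (sigmaF n)) : full_support nu ->
  restriction n (conditional nu s) A =
  (nu (A `&` cylinder s) * (fine (nu (cylinder s)))^-1%:E)%E.
Proof.
move=> fs; rewrite /restriction /= /distribution /pushforward /conditional.
rewrite /mnormalize /= /mrestr setTI.
by rewrite gt_eqF//= -[_ == +oo%E]negbK -ltey -ge0_fin_numE// cylinder_fin_num.
Qed.

Lemma hellingerF_sqr n nu mu w : full_support nu -> full_support mu ->
  let s := mkseq w n in
  hellingerF n nu mu w ^+ 2 =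
  2 * (1 - (Num.sqrt (cond_prob nu s false * cond_prob mu s false) +
            Num.sqrt (cond_prob nu s true * cond_prob mu s true))).
Proof.
move=> fsn fsm s.
have sn : size s = n by rewrite size_mkseq.
set P := restriction n.+1 (conditional nu s).
set Q := restriction n.+1 (conditional mu s).
pose C b : set (sigmaF n.+1) := cylinder (rcons s b).
have mC b : measurable (C b).
  by apply: measurable_cylinder_sigmaF; rewrite size_rcons sn.
have Cs b : C b `<=` cylinder s by rewrite /C cylinder_rcons; exact: subIsetl.
have PC b : P (C b) = (cond_prob nu s b)%:E.
  rewrite /P restriction_conditionalE// setIidl//.
  by rewrite EFinM fineK ?cylinder_fin_num.
have QC b : Q (C b) = (cond_prob mu s b)%:E.
  rewrite /Q restriction_conditionalE// setIidl//.
  by rewrite EFinM fineK ?cylinder_fin_num.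
have Q0 b : 0 < cond_prob mu s b by exact: cond_prob_gt0.
have PQ : charge_of_finite_measure P `<< Q.
  apply/null_content_dominatesP => A mA QA0.
  have As : A `&` cylinder s = set0.
    apply/seteqP; split => // v' [Aw sw].
    have wA : cylinder (mkseq v' n.+1) `<=` A `&` cylinder s.
      move=> v; rewrite /cylinder /mkset size_mkseq => vw; split.
        exact: (sigmaF_saturated mA (esym vw) Aw).
      by rewrite -[RHS]sw size_mkseq -(take_mkseq v (leqnSn n)) vw take_mkseq.
    have /eqP : (mu (A `&` cylinder s) * (fine (mu (cylinder s)))^-1%:E = 0)%E.
      by rewrite -(@restriction_conditionalE mu n.+1 s A fsm); exact: QA0.
    rewrite mule_eq0 eqe invr_eq0 [X in _ || X]gt_eqF ?full_support_fine// orbF.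
    apply/negP; rewrite gt_eqF// (lt_le_trans (fsm (mkseq v' n.+1)))//.
    apply: le_measure => //; rewrite inE; first exact: measurable_cylinder.
    apply: measurableI; last exact: measurable_cylinder.
    have := @measurable_to_sigmaF n.+1 measurableT _ mA; rewrite setTI.
    exact.
  have : P A = 0%E by rewrite /P restriction_conditionalE// As measure0 mul0e.
  exact.
rewrite /hellingerF /hellinger -/P -/Q.
set f := Radon_Nikodym _ _.
have fint : Q.-integrable setT f := Radon_Nikodym_integrable PQ.
have ffin x : f x \is a fin_num by exact: Radon_Nikodym_fin_num.
have mf := measurable_int _ fint.
pose g (x : sigmaF n.+1) : \bar R := (Num.sqrt (fine (f x)))%:E.
have mg : measurable_fun (setT : set (sigmaF n.+1)) g.
  apply/measurable_EFinP; apply: measurableT_comp => //.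
    exact: (continuous_measurable_fun (@sqrt_continuous R)).
  exact: measurableT_comp.
have g0 x : (0 <= g x)%E by rewrite lee_fin sqrtr_ge0.
have integralC b r : (\int[Q]_(y in C b) cst r y = r * (cond_prob mu s b)%:E)%E.
  by rewrite integral_cst//; congr (_ * _)%E; exact: QC.
have fC b x : C b x -> f x = (cond_prob nu s b / cond_prob mu s b)%:E.
  move=> Cx.
  have fx y : C b y -> f y = f x.
    move=> Cy; apply: (measurable_fun_sigmaF_cst _ mf).
      by move=> z; exact: emeasurable_set1.
    move: Cx Cy; rewrite /C /cylinder /= size_rcons sn => -> ->.
    by [].
  have : (cond_prob nu s b)%:E = (\int[Q]_(y in C b) f y)%E.
    by rewrite -PC; exact: (Radon_Nikodym_integral PQ (mC b)).
  rewrite (eq_integral (cst (f x))); last by move=> y /set_mem/fx ->.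
  rewrite integralC -(fineK (ffin x)).
  by rewrite -EFinM => -[->]; rewrite mulfK// gt_eqF.
have gC b : (\int[Q]_(x in C b) g x =
    (Num.sqrt (cond_prob nu s b * cond_prob mu s b))%:E)%E.
  rewrite (eq_integral (cst (Num.sqrt (cond_prob nu s b / cond_prob mu s b))%:E)).
    rewrite integralC -EFinM; congr EFin.
    rewrite -[X in _ * X](ger0_norm (ltW (Q0 b))) -sqrtr_sqr -sqrtrM; last first.
      by rewrite divr_ge0// ltW// cond_prob_gt0.
    by rewrite expr2 mulrA divfK// gt_eqF.
  by move=> y /set_mem/fC yC; rewrite /g yC.
have CC : C false `|` C true = cylinder s by rewrite /C -cylinder_split.
have mS : measurable (C false `|` C true) by exact: measurableU.
have QS0 : Q (~` (C false `|` C true)) = 0%E.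
  by rewrite CC /Q restriction_conditionalE// setICl measure0 mul0e.
have -> : ('E_Q[fun x => Num.sqrt (fine (f x))] =
    (Num.sqrt (cond_prob nu s false * cond_prob mu s false) +
     Num.sqrt (cond_prob nu s true * cond_prob mu s true))%:E)%E.
  rewrite unlock -/(integral _ _ g) -(setUv (C false `|` C true)).
  rewrite ge0_integral_setU//; last 3 first.
  - exact: measurableC.
  - by rewrite setUv.
  - exact/disj_setPCl.
  rewrite ge0_integral_setU//; last 2 first.
  - exact: measurable_funTS.
  - by apply/disj_setPS; rewrite /C cylinder_split_disj.
  rewrite (null_set_integral _ _ QS0) ?adde0 ?gC//; first exact: measurableC.
  exact: measurable_funTS.
rewrite /= sqr_sqrtr// mulr_ge0// subr_ge0.
have := cond_probD s fsn; have := cond_probD s fsm.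
have amgm b : 2 * Num.sqrt (cond_prob nu s b * cond_prob mu s b) <=
    cond_prob nu s b + cond_prob mu s b.
  rewrite sqrtrM ?(ltW (cond_prob_gt0 _ _ _))//.
  have := sqr_ge0 (Num.sqrt (cond_prob nu s b) - Num.sqrt (cond_prob mu s b)).
  rewrite sqrrB !sqr_sqrtr ?(ltW (cond_prob_gt0 _ _ _))// mulr2n.
  by move: (Num.sqrt _ * _) => ?; lra.
by move: (amgm false) (amgm true); lra.
Qed.

End hellinger.

(** * Rational approximation of conditional probabilities *)

Lemma ratio_approx (R : realFieldType) (eps u v u' v' : R) :
  0 < eps <= 2^-1 -> 0 < u' -> 0 < v' ->
  `|u - u'| <= eps * u' -> `|v - v'| <= eps * v' ->
  u / (u + v) <= (1 + 4 * eps) * (u' / (u' + v')) /\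
  u' / (u' + v') <= (1 + 4 * eps) * (u / (u + v)).
Proof.
move=> /andP[e0 e1] u'0 v'0; rewrite !ler_norml => /andP[u1 u2] /andP[v1 v2].
have eu : eps * u' <= 2^-1 * u' by rewrite ler_pM2r.
have ev : eps * v' <= 2^-1 * v' by rewrite ler_pM2r.
have u0 : 0 < u by lra.
have v0 : 0 < v by lra.
have e4 : 1 + eps <= (1 + 4 * eps) * (1 - eps).
  have : eps * eps <= 2^-1 * eps by rewrite ler_pM2r.
  by move=> ?; lra.
have s0 : 0 < u + v by rewrite addr_gt0.
have s'0 : 0 < u' + v' by rewrite addr_gt0.
rewrite !mulrA !ler_pdivrMr// ![_ / _ * _]mulrAC !ler_pdivlMr//.
have e40 : 0 <= 1 + 4 * eps by lra.
split.
  apply: (@le_trans _ _ ((1 + eps) * u' * (u' + v'))).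
    by rewrite ler_pM2r//; lra.
  apply: (@le_trans _ _ ((1 + 4 * eps) * (1 - eps) * (u' * (u' + v')))).
    by rewrite -mulrA ler_pM2r ?mulr_gt0.
  rewrite -!mulrA ler_wpM2l// mulrCA ler_pM2l//; lra.
apply: (@le_trans _ _ (u' * ((1 + eps) * (u' + v')))).
  by rewrite ler_pM2l//; lra.
apply: (@le_trans _ _ ((1 + 4 * eps) * ((1 - eps) * u') * (u' + v'))).
  rewrite mulrA ler_pM2r// mulrC [X in _ <= X]mulrA ler_pM2r//.
by rewrite ler_pM2r// ler_wpM2l//; lra.
Qed.

Section rational.
Variable R : realType.
Implicit Types (nu : probability cantor R) (P : seq bool -> bool -> nat).

Definition delta (n : nat) : R := (2 * n.+1 * n.+2)%:R^-1.

Definition rat_prob P s b : R := (P s b)%:R / (P s false + P s true)%:R.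

Definition approximates P nu := forall s b,
  cond_prob nu s b <= (1 + delta (size s)) * rat_prob P s b /\
  rat_prob P s b <= (1 + delta (size s)) * cond_prob nu s b.

Definition recursive_weights P :=
  (forall b, recursive_on_strings (P^~ b)) /\ (forall s b, (0 < P s b)%N).

Lemma exists_approximation nu : computable_measure nu -> full_support nu ->
  exists P, recursive_weights P /\ approximates P nu.
Proof.
move=> [a [b [c [ra rb rc abc]]]] fs.
pose num e s k := (a (string_code (rcons s e)) k - b (string_code (rcons s e)) k)%N.
pose den e s k := (c (string_code (rcons s e)) k).+1.
pose M (s : seq bool) := (8 * (size s).+1 * (size s).+2)%N.
pose T s k := ((M s * den false s k <= num false s k * 2 ^ k) &&
               (M s * den true s k <= num true s k * 2 ^ k))%N.
have nuE s : fine (nu (cylinder s)) =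
    fine (nu (cylinder (rcons s false))) + fine (nu (cylinder (rcons s true))).
  by rewrite cylinder_measure_rcons fineD// cylinder_fin_num.
have Te s k e : (M s).+1%:R * 2^-1 ^+ k <= fine (nu (cylinder (rcons s e))) ->
    (M s * den e s k <= num e s k * 2 ^ k)%N.
  move=> le; have := abc (rcons s e) k; rewrite ler_norml => /andP[_ h].
  have h2 : (M s)%:R * 2^-1 ^+ k <= ((a (string_code (rcons s e)) k)%:R -
      (b (string_code (rcons s e)) k)%:R) / (den e s k)%:R :> R.
    rewrite -natr1 mulrDl mul1r in le.
    by rewrite -(lerD2r (2^-1 ^+ k)) (le_trans le)// addrC -lerBlDr.
  rewrite ler_pdivlMr ?ltr0n// in h2.
  have : (b (string_code (rcons s e)) k <= a (string_code (rcons s e)) k)%N.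
    by rewrite -(ler_nat R) -subr_ge0 (le_trans _ h2).
  move=> ba; rewrite -natrB// -/(num e s k) in h2.
  rewrite -(ler_nat R) natrM [X in _ <= X]natrM natrX -ler_pdivrMr ?exprn_gt0//.
  by rewrite -exprVn mulrAC.
have T_ex s : exists k, T s k.
  pose mn := Num.min (fine (nu (cylinder (rcons s false))))
    (fine (nu (cylinder (rcons s true)))).
  have mn0 : 0 < mn by rewrite lt_min !full_support_fine.
  pose k := Num.truncn ((M s).+1%:R / mn); exists k.+1.
  have : (M s).+1%:R * 2^-1 ^+ k.+1 <= mn.
    rewrite exprVn ler_pdivrMr ?exprn_gt0// mulrC -ler_pdivrMr//.
    have : (M s).+1%:R / mn < k.+1%:R by apply: truncnS_gt.
    move=> /ltW/le_trans; apply; rewrite -natrX ler_nat.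
    by rewrite ltnW// ltn_expl.
  rewrite le_min => /andP[h0 h1]; apply/andP.
  by split; exact: Te.
pose K s := ex_minn (T_ex s).
have KT s : T s (K s) by rewrite /K; case: ex_minnP.
pose P s e := (num e s (K s) * den (~~ e) s (K s))%N.
have num0 s e : (0 < num e s (K s))%N.
  have /andP[Tf Tt] := KT s.
  by rewrite lt0n; apply/negP => /eqP n0; case: e n0 => n0;
    [move: Tt|move: Tf]; rewrite n0 mul0n leqn0 !muln_eq0.
exists P; split; last first.
  move=> s e.
  have M0 : (0 < M s)%N by rewrite !muln_gt0.
  pose eps : R := (M s)%:R^-1.
  have -> : delta (size s) = 4 * eps.
    rewrite /delta /eps /M !natrM !invfM.
    by move: (size s).+1%:R^-1 (size s).+2%:R^-1 => u v; field.
  have e2 : 0 < eps <= 2^-1.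
    rewrite invr_gt0 ltr0n M0 lef_pV2 ?posrE ?ltr0n// ler_nat.
    by rewrite /M -mulnA -[2%N]muln1 leq_mul// muln_gt0.
  pose r i : R := (num i s (K s))%:R / (den i s (K s))%:R.
  have r0 i : 0 < r i by rewrite divr_gt0 ?ltr0n.
  have nur i : `|fine (nu (cylinder (rcons s i))) - r i| <= eps * r i.
    have := abc (rcons s i) (K s); rewrite -natrB.
      move=> /le_trans; apply.
      rewrite /eps mulrC ler_pdivlMr ?ltr0n// /r ler_pdivlMr ?ltr0n//.
      rewrite exprVn -mulrA -natrM mulrC ler_pdivrMr ?exprn_gt0//.
      rewrite -natrX -natrM ler_nat.
      by have /andP[? ?] := KT s; case: i.
    by apply: ltnW; rewrite -subn_gt0 num0.
  have PE i : rat_prob P s i = r i / (r false + r true).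
    rewrite /rat_prob /P /r natrD; case: i; rewrite ![~~ _]/= !natrM;
    have := (ltr0Sn R (c (string_code (rcons s false)) (K s)));
    have := (ltr0Sn R (c (string_code (rcons s true)) (K s)));
    have := num0 s false; have := num0 s true; rewrite -2!(ltr0n R);
    rewrite -/(den false s (K s)) -/(den true s (K s));
    move: (den false _ _)%:R (den true _ _)%:R;
    move: (num false _ _)%:R (num true _ _)%:R => x y u v y0 x0 v0 u0;
    have h : x * v + y * u != 0 by rewrite gt_eqF// addr_gt0// mulr_gt0.
      by field; rewrite h !gt_eqF.
    by field; rewrite h !gt_eqF.
  rewrite /cond_prob (nuE s) PE.
  case: e; last exact: ratio_approx e2 (r0 _) (r0 _) (nur _) (nur _).
  rewrite [r _ + _]addrC [fine _ + _]addrC.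
  exact: ratio_approx e2 (r0 _) (r0 _) (nur _) (nur _).
split; last by move=> s e; rewrite muln_gt0 num0.
have rs2 : @recursive_string 2 (fun y => string_of (thead (tbehead y))).
  exact/recursive_string_of/recursive_tbehead/recursive_thead.
have r1 : @recursive 2 (fun y => thead y) by exact: recursive_thead.
have rnum2 e : @recursive 2 (fun y => num e (string_of (thead (tbehead y))) (thead y)).
  by apply: recursive_sub; apply: recursive_comp2 => //; exact: recursive_rcons.
have rden2 e : @recursive 2 (fun y => den e (string_of (thead (tbehead y))) (thead y)).
  by apply: recursive_S; apply: recursive_comp2 => //; exact: recursive_rcons.
have rM : @recursive 2 (fun y => M (string_of (thead (tbehead y)))).
  have rs := recursive_size rs2.
  apply: recursive_mul; last exact/recursive_S/recursive_S.
  by apply: recursive_mul; [exact: recursive_const|exact: recursive_S].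
have rK : recursive_on_strings K.
  apply: (recursive_ex_minn (p := fun k x => T (string_of (thead x)) k)
    (fun x => T_ex (string_of (thead x)))).
  by apply: recursive_and; apply: recursive_leq; apply: recursive_mul => //;
    exact: recursive_expn.
have rc2 (f : seq bool -> nat -> nat) :
    @recursive 2 (fun y => f (string_of (thead (tbehead y))) (thead y)) ->
    recursive_on_strings (fun s => f s (K s)).
  move=> rf; apply: eq_recursive (recursive_cons rf rK) => x.
  by rewrite tbehead_cons theadE.
move=> e; exact: recursive_mul (rc2 _ (rnum2 e)) (rc2 _ (rden2 (~~ e))).
Qed.
End rational.

(** * Products along prefixes *)

Section prefix_product.
Variable R : realType.
Implicit Types (f g : seq bool -> bool -> R).

Definition prefix_prod f (s : seq bool) : R :=
  \prod_(i < size s) f (take i s) (nth false s i).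

Lemma prefix_prod_nil f : prefix_prod f [::] = 1.
Proof. by rewrite /prefix_prod big_ord0. Qed.

Lemma prefix_prod_rcons f s b :
  prefix_prod f (rcons s b) = prefix_prod f s * f s b.
Proof.
rewrite /prefix_prod size_rcons big_ord_recr /= nth_rcons ltnn eqxx.
rewrite -cats1 take_size_cat//; congr (_ * _); apply: eq_bigr => i _.
by rewrite nth_cat ltn_ord take_cat ltn_ord.
Qed.

Lemma prefix_prodM f g s :
  prefix_prod (fun s b => f s b * g s b) s = prefix_prod f s * prefix_prod g s.
Proof. exact: big_split. Qed.

Lemma prefix_prodX f n s :
  prefix_prod (fun s b => f s b ^+ n) s = prefix_prod f s ^+ n.
Proof. exact: prodrXl. Qed.

Lemma prefix_prod_ge0 f s : (forall s b, 0 <= f s b) -> 0 <= prefix_prod f s.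
Proof. by move=> f0; apply: prodr_ge0. Qed.

Lemma prefix_prod_gt0 f s : (forall s b, 0 < f s b) -> 0 < prefix_prod f s.
Proof. by move=> f0; apply: prodr_gt0. Qed.

Lemma ler_prefix_prod f g s : (forall s b, 0 <= f s b <= g s b) ->
  prefix_prod f s <= prefix_prod g s.
Proof. by move=> fg; apply: ler_prod. Qed.

Lemma delta_telescope n : 2 * delta R n = n.+1%:R^-1 - n.+2%:R^-1.
Proof.
rewrite /delta !natrM.
have n1 : n.+1%:R != 0 :> R by rewrite pnatr_eq0.
have n2 : n.+2%:R != 0 :> R by rewrite pnatr_eq0.
move: n1 n2; rewrite -[n.+2%:R]natr1; move: (n.+1%:R) => u u0 u1.
by field; rewrite u0 u1.
Qed.

Lemma delta_gt0 n : 0 < delta R n.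
Proof. by rewrite invr_gt0 ltr0n. Qed.

(* The product of the factors [1 + delta i] stays below [2 - 1 / n.+1]. *)
Lemma prefix_prod_delta f g s :
  (forall s b, 0 <= g s b) ->
  (forall s b, 0 <= f s b <= (1 + delta R (size s)) * g s b) ->
  prefix_prod f s <= 2 * prefix_prod g s.
Proof.
move=> g0 fg.
suff : prefix_prod f s <= (2 - (size s).+1%:R^-1) * prefix_prod g s.
  move=> /le_trans; apply; apply: ler_wpM2r; first exact: prefix_prod_ge0.
  by rewrite gerBl invr_ge0.
elim/last_ind: s => [|s b IH].
  by rewrite !prefix_prod_nil /= invr1 mulr1; lra.
rewrite !prefix_prod_rcons size_rcons.
have /andP[f0 fg'] := fg s b.
apply: le_trans (ler_pM _ f0 IH fg') _.
  by apply: prefix_prod_ge0 => t c; have /andP[] := fg t c.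
rewrite mulrACA; apply: ler_wpM2r.
  by rewrite mulr_ge0//; exact: prefix_prod_ge0.
have := delta_telescope (size s); have := delta_gt0 (size s).
set d := delta _ _; have : 0 < (size s).+1%:R^-1 :> R by rewrite invr_gt0.
move: (_.+1%:R^-1) => u; move: (_.+2%:R^-1) => v u0 d0 e.
by have : 0 < u * d by [rewrite mulr_gt0]; move=> ?; lra.
Qed.

Lemma conditional_extension f :
  (forall s b, 0 <= f s b) -> (forall s, f s false + f s true = 1) ->
  exists mu : probability cantor R,
    forall s, mu (cylinder s) = (prefix_prod f s)%:E.
Proof.
move=> f0 f1; apply: cylinder_extension.
- exact: prefix_prod_nil.
- by move=> s; exact: prefix_prod_ge0.
- by move=> s; rewrite !prefix_prod_rcons -mulrDr f1 mulr1.
Qed.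

Lemma cond_prob_prod (nu : probability cantor R) s : full_support nu ->
  fine (nu (cylinder s)) = prefix_prod (cond_prob nu) s.
Proof.
move=> fs; elim/last_ind: s => [|s b IH].
  by rewrite prefix_prod_nil cylinder_nil probability_setT.
by rewrite prefix_prod_rcons -IH /cond_prob mulrC divfK// gt_eqF// full_support_fine.
Qed.

End prefix_product.

Lemma recursive_prefix_prod (f : seq bool -> bool -> nat) :
  (forall b, recursive_on_strings (f^~ b)) ->
  recursive_on_strings (fun s => \prod_(i < size s) f (take i s) (nth false s i)).
Proof.
move=> rf.
have rs : @recursive_string 1 (fun x => string_of (thead x)).
  exact/recursive_string_of/recursive_thead.
apply: (recursive_bigprod (recursive_size rs)
  (f := fun i x => f (take i (string_of (thead x))) (nth false (string_of (thead x)) i))).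
have rs' : @recursive_string 2 (fun x => string_of (thead (tbehead x))).
  exact: recursive_tbehead rs.
have rt := recursive_take rs' (recursive_thead 1).
apply: (eq_recursive (f := fun y => if nth false (string_of (thead (tbehead y))) (thead y)
  then f (take (thead y) (string_of (thead (tbehead y)))) true
  else f (take (thead y) (string_of (thead (tbehead y)))) false)).
  by move=> y; case: nth.
apply: recursive_if.
- exact: (recursive_nth rs' (recursive_thead _)).
- exact: (recursive_string_comp (rf true) rt).
- exact: (recursive_string_comp (rf false) rt).
Qed.

(** * Martin-Löf tests *)

Section tests.
Variable R : realType.
Implicit Types (nu mu : probability cantor R) (T : nat -> seq bool -> bool).

(* A c.e. open set must be enumerated by a total sequence. If no level of the
   test is left by [w], then each level is nonempty and its first element can be
   repeated. *)
Lemma MLR_decidable_test nu T w :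
  @recursive 2 (fun y => T (thead y) (string_of (thead (tbehead y))) : nat) ->
  (forall m, nu (\bigcup_(s in [set s | T m s]) cylinder s) <= (2^-1 ^+ m)%:E)%E ->
  MLR nu w -> exists m, forall n, ~~ T m (mkseq w n).
Proof.
move=> rT nuT Mw; apply: contrapT => /forallNP Tw.
have T_ex m : exists k, T m (string_of k).
  have /existsNP [n /negP] := Tw m; rewrite negbK => Tn.
  by exists (string_code (mkseq w n)); rewrite string_codeK.
pose c m i := if T m (string_of i) then i else ex_minn (T_ex m).
have Tc m i : T m (string_of (c m i)).
  by rewrite /c; case: ifP => // _; case: ex_minnP.
pose U m := \bigcup_(s in [set s | T m s]) cylinder s.
have UE m : U m = \bigcup_i cylinder (string_of (c m i)).
  apply/seteqP; split => v.
    case=> s Ts vs; exists (string_code s) => //.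
    by rewrite /c string_codeK ifT// string_codeK.
  by case=> i _ vi; exists (string_of (c m i)) => //; exact: Tc.
apply: (Mw U).
- exists (fun m i => string_of (c m i)); split=> [|m]; last exact: UE.
  rewrite /recursive2.
  apply: (eq_recursive (f := fun y => c (thead y) (thead (tbehead y)))).
    move=> y; rewrite string_ofK; congr c;
      by rewrite /thead ?tnth_tbehead; congr tnth; exact: val_inj.
  apply: recursive_if => //; first exact/recursive_tbehead/recursive_thead.
  have rm : @recursive 1 (fun x => ex_minn (T_ex (thead x))).
    apply: (recursive_ex_minn (p := fun k x => T (thead x) (string_of k))
      (fun x => T_ex (thead x))).
    pose h (i : 'I_2) (y : 2.-tuple nat) := tnth y (rev_ord i).
    have rh i : recursive (h i) by exact: recursive_proj.
    apply: eq_recursive (recursive_comp rT rh) => y.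
    rewrite /thead !tnth_tbehead !tnth_mktuple /h.
    congr (nat_of_bool (T (tnth y _) (string_of (tnth y _)))); exact: val_inj.
  exact: (recursive_comp1 (g := fun m => ex_minn (T_ex m)) rm (recursive_thead _)).
- exact: nuT.
- move=> m _; have /existsNP [n /negP] := Tw m; rewrite negbK => Tn.
  by exists (mkseq w n) => //; exact: cylinder_mkseq.
Qed.

End tests.

(** * Random points have finite sums *)

Section discrimination.
Variable R : realType.
Implicit Types (x y : bool -> R).

Definition affinity x y : R :=
  Num.sqrt (x false * y false) + Num.sqrt (x true * y true).

(* A quarter of the triangular discrimination
   [\sum_b (x b - y b) ^+ 2 / (x b + y b)] of two distributions on [bool]. *)
Definition discrimination x y : R :=
  (x false - y false) ^+ 2 / (2 * (x false + y false) * (x true + y true)).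

Lemma discriminationC x y : discrimination x y = discrimination y x.
Proof.
by rewrite /discrimination -sqrrN opprB [x false + _]addrC [x true + _]addrC.
Qed.

Lemma affinityE x y : (forall b, 0 <= x b) -> (forall b, 0 <= y b) ->
  x false + x true = 1 -> y false + y true = 1 ->
  2 * (1 - affinity x y) = (Num.sqrt (x false) - Num.sqrt (y false)) ^+ 2 +
    (Num.sqrt (x true) - Num.sqrt (y true)) ^+ 2.
Proof.
move=> x0 y0 x1 y1; rewrite /affinity !sqrtrM// !sqrrB !sqr_sqrtr//.
by lra.
Qed.

Lemma sqr_sqrt_sub_bounds (u v : R) : 0 < u -> 0 < v ->
  (u - v) ^+ 2 / (2 * (u + v)) <= (Num.sqrt u - Num.sqrt v) ^+ 2 <=
  (u - v) ^+ 2 / (u + v).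
Proof.
move=> u0 v0.
have s0 : 0 < u + v by rewrite addr_gt0.
rewrite ler_pdivrMr ?mulr_gt0// ler_pdivlMr//.
rewrite -{1 3 5 6}(sqr_sqrtr (ltW u0)) -{1 3 5 6}(sqr_sqrtr (ltW v0)).
move: (Num.sqrt u) (Num.sqrt v) (sqrtr_ge0 u) (sqrtr_ge0 v) => a b a0 b0.
rewrite !subr_sqr !exprMn; apply/andP; split; apply: ler_wpM2l; rewrite ?sqr_ge0//.
  by have := sqr_ge0 (a - b); rewrite sqrrB sqrrD => ?; lra.
by have : 0 <= a * b by [rewrite mulr_ge0]; rewrite sqrrD => ?; lra.
Qed.

Lemma discrimination_affinity x y : (forall b, 0 < x b) -> (forall b, 0 < y b) ->
  x false + x true = 1 -> y false + y true = 1 ->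
  discrimination x y <= 1 - affinity x y <= 2 * discrimination x y.
Proof.
move=> x0 y0 x1 y1.
have := affinityE (fun b => ltW (x0 b)) (fun b => ltW (y0 b)) x1 y1.
have /andP[f1 f2] := sqr_sqrt_sub_bounds (x0 false) (y0 false).
have /andP[t1 t2] := sqr_sqrt_sub_bounds (x0 true) (y0 true).
have e : (x true - y true) ^+ 2 = (x false - y false) ^+ 2.
  by rewrite -sqrrN; congr (_ ^+ 2); lra.
have sf : x false + y false != 0 by rewrite gt_eqF// addr_gt0.
have st : x true + y true != 0 by rewrite gt_eqF// addr_gt0.
have d4 : 4 * discrimination x y =
  (x false - y false) ^+ 2 / (x false + y false) +
  (x true - y true) ^+ 2 / (x true + y true).
  rewrite e /discrimination.
  transitivity ((x false - y false) ^+ 2 *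
      (x false + x true + (y false + y true)) /
      ((x false + y false) * (x true + y true))).
    by rewrite x1 y1; field; rewrite sf st.
  by field; rewrite sf st.
have half (a b : R) : a / (2 * b) = 2^-1 * (a / b) by rewrite invfM mulrCA.
rewrite !half in f1 t1.
by move=> E; apply/andP; split; lra.
Qed.

Lemma discrimination_ge0 x y : (forall b, 0 < x b) -> (forall b, 0 < y b) ->
  0 <= discrimination x y.
Proof.
by move=> x0 y0; rewrite divr_ge0 ?sqr_ge0// !mulr_ge0// addr_ge0// ltW.
Qed.

Lemma sqr_sqrt_sub_le (u v : R) : 0 <= u -> 0 <= v ->
  (Num.sqrt u - Num.sqrt v) ^+ 2 <= `|u - v|.
Proof.
move=> u0 v0; rewrite -[X in `|X - _|]sqr_sqrtr// -[X in `|_ - X|]sqr_sqrtr//.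
rewrite subr_sqr normrM -real_normK ?num_real// expr2; apply: ler_wpM2l => //.
by rewrite [X in _ <= X]ger0_norm ?addr_ge0// (le_trans (ler_normB _ _))// !ger0_norm.
Qed.

(* Each affinity gap is half of a squared Euclidean distance. *)
Lemma affinity_triangle x x' y y' :
  (forall b, 0 <= x b) -> (forall b, 0 <= x' b) ->
  (forall b, 0 <= y b) -> (forall b, 0 <= y' b) ->
  x false + x true = 1 -> x' false + x' true = 1 ->
  y false + y true = 1 -> y' false + y' true = 1 ->
  1 - affinity x y <= 3 * (1 - affinity x x' + (1 - affinity x' y') + (1 - affinity y' y)).
Proof.
move=> x0 x'0 y0 y'0 x1 x'1 y1 y'1.
have := affinityE x0 y0 x1 y1; have := affinityE x0 x'0 x1 x'1.
have := affinityE x'0 y'0 x'1 y'1; have := affinityE y'0 y0 y'1 y1.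
have cs (a b c d : R) :
    (a - d) ^+ 2 <= 3 * ((a - b) ^+ 2 + (b - c) ^+ 2 + (c - d) ^+ 2).
  have := sqr_ge0 ((a - b) - (b - c)); have := sqr_ge0 ((b - c) - (c - d)).
  have := sqr_ge0 ((a - b) - (c - d)).
  have -> : a - d = (a - b) + (b - c) + (c - d) by lra.
  by move: (a - b) (b - c) (c - d) => p q r; nra.
have := cs (Num.sqrt (x false)) (Num.sqrt (x' false)) (Num.sqrt (y' false)) (Num.sqrt (y false)).
have := cs (Num.sqrt (x true)) (Num.sqrt (x' true)) (Num.sqrt (y' true)) (Num.sqrt (y true)).
by lra.
Qed.

Lemma affinity_close x y (d : R) : 0 <= d ->
  (forall b, 0 <= x b) -> (forall b, 0 <= y b) ->
  x false + x true = 1 -> y false + y true = 1 ->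
  (forall b, x b <= (1 + d) * y b /\ y b <= (1 + d) * x b) ->
  1 - affinity x y <= d.
Proof.
move=> d0 x0 y0 x1 y1 xy; have := affinityE x0 y0 x1 y1.
have close b : (Num.sqrt (x b) - Num.sqrt (y b)) ^+ 2 <= d.
  apply: le_trans (sqr_sqrt_sub_le (x0 b) (y0 b)) _.
  have le1 (z : bool -> R) : (forall b, 0 <= z b) -> z false + z true = 1 -> z b <= 1.
    by move=> z0 z1; have := z0 false; have := z0 true; case: (b); lra.
  have xb := le1 _ x0 x1; have yb := le1 _ y0 y1.
  have dx : d * x b <= d by rewrite ler_piMr.
  have dy : d * y b <= d by rewrite ler_piMr.
  by have [] := xy b; rewrite ler_norml => ? ?; apply/andP; split; lra.
by move: (close false) (close true); lra.
Qed.

End discrimination.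

Section geometric_test.
Variable R : realType.
Implicit Types (nu mu : probability cantor R) (P Q : seq bool -> bool -> nat).

Lemma rat_prob_gt0 P s b : recursive_weights P -> 0 < rat_prob R P s b.
Proof. by move=> [_ P0]; rewrite divr_gt0 ?ltr0n// addn_gt0 P0. Qed.

Lemma rat_probD P s : recursive_weights P ->
  rat_prob R P s false + rat_prob R P s true = 1.
Proof.
move=> [_ P0]; rewrite -mulrDl -natrD divff// pnatr_eq0 -lt0n.
by rewrite addn_gt0 P0.
Qed.

Definition gain P Q s : R :=
  1 + discrimination (rat_prob R P s) (rat_prob R Q s).

(* Numerators and denominators of
   [rat_prob Q s b / rat_prob P s b * gain P Q s ^+ 2]. *)
Let cross P Q s b := (P s b * (Q s false + Q s true))%N.
Let disc_den P Q s := (2 * (cross P Q s false + cross Q P s false) *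
  (cross P Q s true + cross Q P s true))%N.
Let disc_num P Q s := ((cross P Q s false - cross Q P s false) +
  (cross Q P s false - cross P Q s false))%N.
Let step_den P Q s b := (cross P Q s b * (disc_den P Q s * disc_den P Q s))%N.
Let step_num P Q s b := (cross Q P s b *
  ((disc_den P Q s + disc_num P Q s * disc_num P Q s) *
   (disc_den P Q s + disc_num P Q s * disc_num P Q s)))%N.

Definition geometric_test P Q m s :=
  (4 ^ m * (\prod_(i < size s) step_den P Q (take i s) (nth false s i)) <
   \prod_(i < size s) step_num P Q (take i s) (nth false s i))%N.

Lemma geometric_testE P Q m s : recursive_weights P -> recursive_weights Q ->
  geometric_test P Q m s = (4 ^+ m < prefix_prod (fun s b =>
    rat_prob R Q s b / rat_prob R P s b * gain P Q s ^+ 2) s).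
Proof.
move=> rP rQ.
have den0 t : (0 < disc_den P Q t)%N.
  by rewrite !(muln_gt0, addn_gt0) !rP.2 !rQ.2.
have sden0 t b : (0 < step_den P Q t b)%N by rewrite !(muln_gt0, addn_gt0) !rP.2 !rQ.2.
have stepE t b : (step_num P Q t b)%:R = (step_den P Q t b)%:R *
    (rat_prob R Q t b / rat_prob R P t b * gain P Q t ^+ 2).
  have [p0 p1 q0 q1] : [/\ 0 < (P t false)%:R :> R, 0 < (P t true)%:R :> R,
      0 < (Q t false)%:R :> R & 0 < (Q t true)%:R :> R].
    by rewrite !ltr0n rP.2 !rQ.2 rP.2.
  have dE : ((disc_num P Q t * disc_num P Q t)%N%:R : R) =
      ((cross P Q t false)%:R - (cross Q P t false)%:R) ^+ 2.
    rewrite natrM -expr2 /disc_num; case: (leqP (cross P Q t false) (cross Q P t false)) => h.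
      by rewrite (eqP h) add0n natrB// -sqrrN opprB.
    by rewrite (eqP (ltnW h)) addn0 natrB// ltnW.
  rewrite /step_num /step_den /gain /discrimination /rat_prob.
  rewrite !natrM !natrD dE /disc_den !natrM !natrD /cross !natrM !natrD.
  have pb : 0 < (P t b)%:R :> R by rewrite ltr0n rP.2.
  move: p0 p1 q0 q1 pb; move: (P t b)%:R (Q t b)%:R.
  move: (P t false)%:R (P t true)%:R (Q t false)%:R (Q t true)%:R.
  move=> p0 p1 q0 q1 pb qb p00 p10 q00 q10 pb0.
  have ps : p0 + p1 != 0 by rewrite gt_eqF// addr_gt0.
  have qs : q0 + q1 != 0 by rewrite gt_eqF// addr_gt0.
  have s0 : p0 * (q0 + q1) + q0 * (p0 + p1) != 0.
    by rewrite gt_eqF// !(addr_gt0, mulr_gt0).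
  have s1 : p1 * (q0 + q1) + q1 * (p0 + p1) != 0.
    by rewrite gt_eqF// !(addr_gt0, mulr_gt0).
  by field; rewrite ps qs s0 s1 gt_eqF.
have prodE : (\prod_(i < size s) step_num P Q (take i s) (nth false s i))%:R =
    (\prod_(i < size s) step_den P Q (take i s) (nth false s i))%:R *
    prefix_prod (fun s b => rat_prob R Q s b / rat_prob R P s b * gain P Q s ^+ 2) s.
  rewrite !natr_prod /prefix_prod -big_split; apply: eq_bigr => i _.
  exact: stepE.
rewrite /geometric_test -(ltr_nat R) prodE natrM natrX mulrC ltr_pM2l//.
by rewrite natr_prod prodr_gt0// => i _; rewrite ltr0n.
Qed.

Lemma recursive_geometric_test P Q : recursive_weights P -> recursive_weights Q ->
  @recursive 2 (fun y => geometric_test P Q (thead y) (string_of (thead (tbehead y))) : nat).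
Proof.
move=> [rP _] [rQ _].
have rcross P' Q' b : (forall b, recursive_on_strings (P'^~ b)) ->
    (forall b, recursive_on_strings (Q'^~ b)) ->
    recursive_on_strings (cross P' Q' ^~ b).
  by move=> rP' rQ'; apply: recursive_mul; [exact: rP'|exact: recursive_add (rQ' false) (rQ' true)].
have rPQ b := rcross _ _ b rP rQ; have rQP b := rcross _ _ b rQ rP.
have rnum : recursive_on_strings (disc_num P Q).
  exact: recursive_add (recursive_sub (rPQ false) (rQP false))
    (recursive_sub (rQP false) (rPQ false)).
have rden : recursive_on_strings (disc_den P Q).
  exact: recursive_mul (recursive_mul (recursive_const _ 2)
    (recursive_add (rPQ false) (rQP false))) (recursive_add (rPQ true) (rQP true)).
have rs : @recursive_string 2 (fun y => string_of (thead (tbehead y))).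
  exact/recursive_string_of/recursive_tbehead/recursive_thead.
have rstep_num b : recursive_on_strings (step_num P Q ^~ b).
  have ra := recursive_add rden (recursive_mul rnum rnum).
  exact: recursive_mul (rQP b) (recursive_mul ra ra).
have rstep_den b : recursive_on_strings (step_den P Q ^~ b).
  exact: recursive_mul (rPQ b) (recursive_mul rden rden).
apply: recursive_ltn; last first.
  exact: (recursive_string_comp (recursive_prefix_prod rstep_num) rs).
apply: recursive_mul; first exact/recursive_expn/recursive_thead.
exact: (recursive_string_comp (recursive_prefix_prod rstep_den) rs).
Qed.

(* The normalised geometric mean of the two measures dominates
   [nu] by the factor [2 ^ m] on the [m]-th level. *)
Lemma measure_geometric_test nu P Q m : full_support nu ->
  recursive_weights P -> recursive_weights Q -> approximates P nu ->
  (nu (\bigcup_(s in [set s | geometric_test P Q m s]) cylinder s) <=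
   (2 * 2^-1 ^+ m)%:E)%E.
Proof.
move=> fs rP rQ Pnu.
pose x := rat_prob R P; pose y := rat_prob R Q.
have x0 s b : 0 < x s b by exact: rat_prob_gt0.
have y0 s b : 0 < y s b by exact: rat_prob_gt0.
pose E s := affinity (x s) (y s).
have E0 s : 0 < E s by rewrite addr_gt0// sqrtr_gt0 mulr_gt0.
pose g s b := Num.sqrt (x s b * y s b) / E s.
have g0 s b : 0 <= g s b by rewrite divr_ge0 ?sqrtr_ge0// ltW.
have [la laE] : exists la : probability cantor R,
    forall s, la (cylinder s) = (prefix_prod g s)%:E.
  apply: conditional_extension => // s.
  by rewrite -mulrDl -/(affinity (x s) (y s)) -/(E s) divff// gt_eqF.
have gain_ge0 s : 0 <= gain P Q s.
  exact: addr_ge0 ler01 (discrimination_ge0 (x0 s) (y0 s)).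
have gE s b : 0 <= Num.sqrt (x s b * y s b) * gain P Q s <= g s b.
  rewrite mulr_ge0 ?sqrtr_ge0//= /g ler_wpM2l ?sqrtr_ge0//.
  rewrite -[X in _ <= X]div1r ler_pdivlMr// /gain.
  have /andP[h _] := discrimination_affinity (x0 s) (y0 s)
    (rat_probD s rP) (rat_probD s rQ).
  have := sqr_ge0 (1 - E s); rewrite expr2 => ?.
  have := ler_wpM2r (ltW (E0 s)) h; rewrite -/(E s) => ?; lra.
have nux s : fine (nu (cylinder s)) <= 2 * prefix_prod x s.
  rewrite cond_prob_prod//; apply: prefix_prod_delta => [t b|t b]; first exact: ltW.
  by rewrite ltW ?cond_prob_gt0//= (Pnu t b).1.
have main s : geometric_test P Q m s -> 2 ^+ m * prefix_prod x s <= prefix_prod g s.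
  rewrite geometric_testE// => Ts.
  apply: le_trans (ler_prefix_prod s gE).
  rewrite -ler_sqr ?nnegrE; last 2 first.
  - by rewrite mulr_ge0 ?exprn_ge0// prefix_prod_ge0// => t b; exact: ltW.
  - by apply: prefix_prod_ge0 => t b; have /andP[] := gE t b.
  have -> : (2 ^+ m * prefix_prod x s) ^+ 2 = 4 ^+ m * prefix_prod x s ^+ 2.
    by rewrite exprMn exprAC; congr (_ ^+ _ * _); rewrite expr2 -natrM.
  rewrite -!prefix_prodX.
  have -> : prefix_prod (fun s b => (Num.sqrt (x s b * y s b) * gain P Q s) ^+ 2) s =
      prefix_prod (fun s b => y s b / x s b * gain P Q s ^+ 2) s *
      prefix_prod (fun s b => x s b ^+ 2) s.
    rewrite -prefix_prodM /prefix_prod; apply: eq_bigr => i _.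
    set t := take i s; set b := nth false s i.
    rewrite exprMn sqr_sqrtr; last by rewrite mulr_ge0// ltW.
    have := x0 t b; move: (x t b) (y t b) (gain P Q t) => a c d a0.
    by field; rewrite gt_eqF.
  by rewrite ler_wpM2r ?(ltW Ts)// prefix_prod_ge0// => t b; rewrite sqr_ge0.
have K0 : 0 <= 2 * 2^-1 ^+ m :> R by rewrite mulr_ge0.
apply: le_trans (measure_cylinders_le (mu := la) K0 _) _ => [s Ts|].
  rewrite laE -(fineK (cylinder_fin_num nu s)) -EFinM lee_fin.
  apply: le_trans (nux s) _; rewrite -mulrA ler_wpM2l// exprVn.
  by rewrite ler_pdivlMl ?exprn_gt0//; exact: main.
rewrite -[leRHS]mule1 lee_wpmul2l ?lee_fin// probability_le1//.
exact: measurable_bigcup_cylinder.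
Qed.

Lemma MLR_gain_bounded nu P Q w : full_support nu ->
  recursive_weights P -> recursive_weights Q -> approximates P nu ->
  MLR nu w -> exists m, forall n, prefix_prod (fun s b =>
    rat_prob R Q s b / rat_prob R P s b * gain P Q s ^+ 2) (mkseq w n) <= 4 ^+ m.
Proof.
move=> fs rP rQ Pnu Mw.
have rT := recursive_geometric_test rP rQ.
have [|m|m Tm] := @MLR_decidable_test R nu (fun m => geometric_test P Q m.+1) w _ _ Mw.
- pose h (i : 'I_2) (y : 2.-tuple nat) := if i == ord0 then (thead y).+1 else tnth y i.
  have rh i : recursive (h i).
    by rewrite /h; case: eqP => _; [exact/recursive_S/recursive_thead|exact: recursive_proj].
  apply: eq_recursive (recursive_comp rT rh) => y.
  rewrite /thead !tnth_tbehead !tnth_mktuple /h.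
  by congr (nat_of_bool (geometric_test P Q _ (string_of (tnth y _)))); exact: val_inj.
- apply: le_trans (measure_geometric_test m.+1 fs rP rQ Pnu) _.
  by rewrite exprS mulrA mulfV// mul1r.
- by exists m.+1 => n; have := Tm n; rewrite geometric_testE// -leNgt.
Qed.

Lemma MLR_sub_MR2 nu : computable_measure nu -> full_support nu ->
  MLR nu `<=` MR2 nu.
Proof.
move=> cnu fnu w nuw mu cmu fmu numu.
have muw := numu w nuw.
have [P [rP Pnu]] := exists_approximation cnu fnu.
have [Q [rQ Qmu]] := exists_approximation cmu fmu.
have [m1 h1] := MLR_gain_bounded fnu rP rQ Pnu nuw.
have [m2 h2] := MLR_gain_bounded fmu rQ rP Qmu muw.
pose x := rat_prob R P; pose y := rat_prob R Q.
have x0 s b : 0 < x s b by exact: rat_prob_gt0.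
have y0 s b : 0 < y s b by exact: rat_prob_gt0.
pose h n := discrimination (x (mkseq w n)) (y (mkseq w n)).
have hge0 n : 0 <= h n by exact: discrimination_ge0 (x0 _) (y0 _).
have prodE n : prefix_prod (fun s b => gain P Q s ^+ 4) (mkseq w n) =
    \prod_(i < n) (1 + h i) ^+ 4.
  rewrite /prefix_prod size_mkseq; apply: eq_bigr => i _.
  by rewrite take_mkseq// ltnW.
have sum_h n : \sum_(i < n) h i <= 4 ^+ (m1 + m2).
  apply: (@le_trans _ _ (\prod_(i < n) (1 + h i) ^+ 4)).
    apply: (@le_trans _ _ (\prod_(i < n) (1 + h i))).
      suff : 1 + \sum_(i < n) h i <= \prod_(i < n) (1 + h i) by lra.
      elim: n => [|n IH]; first by rewrite !big_ord0 addr0.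
      rewrite !big_ord_recr /= mulrDr mulr1 addrA lerD//.
      rewrite ler_peMl//.
      by apply: (@le_trans _ _ (1 + \sum_(i < n) h i)) => //; rewrite lerDl sumr_ge0.
    apply: ler_prod => i _; rewrite addr_ge0//= ler_eXnr//.
    by rewrite lerDl.
  rewrite -prodE exprD.
  have -> : prefix_prod (fun s b => gain P Q s ^+ 4) (mkseq w n) =
    prefix_prod (fun s b => y s b / x s b * gain P Q s ^+ 2) (mkseq w n) *
    prefix_prod (fun s b => x s b / y s b * gain Q P s ^+ 2) (mkseq w n).
    rewrite -prefix_prodM; apply: eq_bigr => i _.
    set t := take _ _; set b := nth _ _ _.
    have -> : gain Q P t = gain P Q t by rewrite /gain discriminationC.
    have := x0 t b; have := y0 t b.
    move: (x t b) (y t b) (gain P Q t) => a c d a0 c0.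
    by field; rewrite !gt_eqF.
  apply: ler_pM => //; apply: prefix_prod_ge0 => t b;
    by rewrite mulr_ge0 ?sqr_ge0// divr_ge0// ltW.
have H n : hellingerF n nu mu w ^+ 2 <= 12 * (delta R n + h n).
  rewrite hellingerF_sqr//; set s := mkseq w n.
  have p0 b := ltW (cond_prob_gt0 s b fnu).
  have q0 b := ltW (cond_prob_gt0 s b fmu).
  have x0' b : 0 <= x s b by rewrite ltW.
  have y0' b : 0 <= y s b by rewrite ltW.
  have p1 := cond_probD s fnu; have q1 := cond_probD s fmu.
  have x1 : x s false + x s true = 1 := rat_probD s rP.
  have y1 : y s false + y s true = 1 := rat_probD s rQ.
  have := affinity_triangle p0 x0' q0 y0' p1 x1 q1 y1.
  have /andP[_ ] := discrimination_affinity (x0 s) (y0 s) x1 y1.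
  have d0 := ltW (delta_gt0 R n).
  have px b : cond_prob nu s b <= (1 + delta R n) * x s b /\
      x s b <= (1 + delta R n) * cond_prob nu s b.
    by have := Pnu s b; rewrite size_mkseq.
  have yq b : y s b <= (1 + delta R n) * cond_prob mu s b /\
      cond_prob mu s b <= (1 + delta R n) * y s b.
    by have [] := Qmu s b; rewrite size_mkseq.
  have := affinity_close d0 p0 x0' p1 x1 px.
  have := affinity_close d0 y0' q0 y1 q1 yq.
  rewrite -/(h n) -/(affinity (cond_prob nu s) (cond_prob mu s)).
  by lra.
have sum_delta n : \sum_(i < n) delta R i <= 2^-1.
  suff : 2 * \sum_(i < n) delta R i <= 1 - n.+1%:R^-1.
    have u0 : 0 <= n.+1%:R^-1 :> R by rewrite invr_ge0.
    move: (\sum_(i < n) delta R i) (n.+1%:R^-1) u0 => S u u0 h1S; lra.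
  elim: n => [|n IH]; first by rewrite big_ord0 mulr0 invr1 subrr.
  rewrite big_ord_recr mulrDr /= delta_telescope.
  by move: (\sum_(i < n) _) (n.+1%:R^-1) (n.+2%:R^-1) IH => S u v IH; lra.
apply: (@le_lt_trans _ _ (12 * (2^-1 + 4 ^+ (m1 + m2)))%:E); last exact: ltry.
apply: lime_le; first by apply: is_cvg_nneseries => n _ _; rewrite lee_fin sqr_ge0.
apply: nearW => n; rewrite sumEFin lee_fin big_mkord.
apply: (@le_trans _ _ (\sum_(i < n) 12 * (delta R i + h i))).
  by apply: ler_sum => i _; exact: H.
by rewrite -mulr_sumr big_split ler_wpM2l// lerD.
Qed.

End geometric_test.

(** * Nonrandom points have an infinite sum *)

Section first_entries.
Variable s : nat -> nat -> seq bool.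
Implicit Types (t : seq bool) (i j n : nat).

(* [inside j t] is a decidable condition, monotone in [t], such that the
   cylinders of the [t] satisfying it cover the [j]-th level of the test. *)
Definition inside j t :=
  (j <= size t)%N && [exists m : 'I_(size t).+1, prefix (s j m) t].

Definition entry j t :=
  inside j t && ((size t == 0)%N || ~~ inside j (take (size t - 1) t)).

Definition entries t := [exists j : 'I_(size t).+1, entry j t].

Lemma inside_prefix j t t' : prefix t t' -> inside j t -> inside j t'.
Proof.
move=> tt' /andP[jt /existsP[m mt]].
have le := size_prefix tt'.
rewrite /inside (leq_trans jt le); apply/existsP.
exists (widen_ord (le : (size t).+1 <= (size t').+1)%N m).
exact: prefix_trans mt tt'.
Qed.

Lemma entriesP t : reflect (exists j, entry j t) (entries t).
Proof.
apply: (iffP existsP) => [[j jt]|[j jt]]; first by exists (val j).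
have lt : (j < (size t).+1)%N by case/andP: jt => /andP[].
by exists (Ordinal lt).
Qed.

Lemma sum_entry_le j t n : (n <= size t)%N ->
  (\sum_(i < n) entry j (take i t) <= 1)%N.
Proof.
suff E k : (k < size t)%N ->
    (\sum_(i < k.+1) entry j (take i t) = inside j (take k t))%N.
  by case: n => [|n] nt; [rewrite big_ord0|rewrite E// leq_b1].
elim: k => [|k IH] kt; rewrite big_ord_recr /=.
  by rewrite big_ord0 add0n /entry size_take_min min0n eqxx andbT.
rewrite IH ?(ltnW kt)// /entry size_takel ?(ltnW kt)// subn1 /= take_takel//.
have : inside j (take k t) -> inside j (take k.+1 t).
  apply: inside_prefix; rewrite prefixE size_takel; last exact/ltnW/ltnW.
  by rewrite take_takel.
by case: (inside j (take k t)) => [->|_]//; rewrite andbT add0n.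
Qed.

Lemma prod_entries_le (R : realType) n t :
  (forall j i, (n <= j)%N -> ~~ entry j (take i t)) ->
  prefix_prod (fun t' _ => if entries t' then 4 else 1 : R) t <= 4 ^+ n.
Proof.
move=> tn; rewrite /prefix_prod.
have -> : \prod_(i < size t) (if entries (take i t) then 4 else 1 : R) =
    4 ^+ (\sum_(i < size t) entries (take i t)).
  rewrite (big_morph (fun k => 4 ^+ k : R) (exprD 4) (expr0 4)).
  by apply: eq_bigr => i _; case: entries; rewrite ?expr1 ?expr0.
rewrite ler_eXn2l ?ltr1n//.
apply: (@leq_trans (\sum_(i < size t) \sum_(j < n) entry j (take i t))).
  apply: leq_sum => i _; case: entriesP => // -[j jt].
  have jn : (j < n)%N by rewrite ltnNge; apply: contraL jt; exact: tn.
  by rewrite (bigD1 (Ordinal jn)) //= jt.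
rewrite exchange_big /=; apply: (@leq_trans (\sum_(j < n) 1)); last first.
  by rewrite sum1_card card_ord.
by apply: leq_sum => j _; exact: sum_entry_le.
Qed.

Hypothesis rec_s : recursive2 (fun n m => string_code (s n m)).

Lemma recursive_inside k (j : k.-tuple nat -> nat) (t : k.-tuple nat -> seq bool) :
  recursive j -> recursive_string t -> recursive (fun x => inside (j x) (t x) : nat).
Proof.
move=> rj rt; apply: recursive_and; first exact: recursive_leq rj (recursive_size rt).
apply: (recursive_exists (recursive_S (recursive_size rt))
  (b := fun m x => prefix (s (j x) m) (t x))).
apply: recursive_prefix; last exact: recursive_tbehead rt.
exact: recursive_comp2 rec_s (recursive_tbehead rj) (recursive_thead _).
Qed.

Lemma recursive_entries : recursive_on_strings (fun t => entries t : nat).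
Proof.
have rs : @recursive_string 1 (fun x => string_of (thead x)).
  exact/recursive_string_of/recursive_thead.
apply: (recursive_exists (recursive_S (recursive_size rs))
  (b := fun j x => entry j (string_of (thead x)))).
have rs2 : @recursive_string 2 (fun y => string_of (thead (tbehead y))).
  exact: recursive_tbehead rs.
apply: recursive_and; first exact: recursive_inside (recursive_thead _) rs2.
apply: recursive_or.
  exact: recursive_eq (recursive_size rs2) (recursive_const _ 0).
apply: recursive_neg; apply: (recursive_inside (recursive_thead _)).
apply: (recursive_take rs2).
exact: recursive_sub (recursive_size rs2) (recursive_const _ 1).
Qed.

Lemma exists_entry (w : cantor) j : (\bigcup_m cylinder (s j m)) w ->
  exists n, (j <= n)%N /\ entries (mkseq w n).
Proof.
case=> m _ wm.
have ex : exists n, inside j (mkseq w n).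
  exists (maxn j (maxn m (size (s j m)))).
  rewrite /inside size_mkseq leq_maxl; apply/existsP.
  have lt : (m < (maxn j (maxn m (size (s j m)))).+1)%N.
    by rewrite ltnS !leq_max leqnn orbT.
  exists (Ordinal lt) => /=; apply: cylinder_prefix => //.
  by rewrite !leq_max leqnn !orbT.
case: (ex_minnP ex) => n jn mn; exists n; split.
  by move: jn; rewrite /inside size_mkseq => /andP[].
apply/entriesP; exists j; rewrite /entry jn size_mkseq /=.
case: n jn mn => // n jn mn; rewrite subn1 /= take_mkseq//.
by apply/negP => /mn; rewrite ltnn.
Qed.

End first_entries.

Section nonrandom.
Variable R : realType.
Implicit Types (nu mu : probability cantor R) (P Q : seq bool -> bool -> nat).

Lemma weights_measure Q : recursive_weights Q -> exists mu,
  [/\ computable_measure mu, full_support mu &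
      forall t, mu (cylinder t) = (prefix_prod (rat_prob R Q) t)%:E].
Proof.
move=> rQ; have [rec_Q Q0] := rQ.
have [mu muE] : exists mu : probability cantor R,
    forall t, mu (cylinder t) = (prefix_prod (rat_prob R Q) t)%:E.
  apply: conditional_extension => [t b|t]; first by rewrite ltW ?rat_prob_gt0.
  exact: rat_probD.
exists mu; split => //; last first.
  by move=> t; rewrite muE lte_fin; apply: prefix_prod_gt0 => *; exact: rat_prob_gt0.
pose num t := (\prod_(i < size t) Q (take i t) (nth false t i))%N.
pose den t := (\prod_(i < size t) (Q (take i t) false + Q (take i t) true))%N.
have den0 t : (0 < den t)%N by apply: prodn_gt0 => i; rewrite addn_gt0 Q0.
have rnum : recursive_on_strings num by exact: recursive_prefix_prod.
have rden : recursive_on_strings den.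
  by apply: (recursive_prefix_prod (f := fun t _ => (Q t false + Q t true)%N)) => b;
    exact: recursive_add (rec_Q _) (rec_Q _).
have r2 (f : seq bool -> nat) : recursive_on_strings f ->
    recursive2 (fun c _ => f (string_of c)).
  move=> rf; apply: (recursive_comp1 (g := fun c => f (string_of c)) rf).
  exact: recursive_fst.
exists (fun c _ => num (string_of c)), (fun _ _ => 0%N), (fun c _ => (den (string_of c) - 1)%N).
split.
- exact: r2.
- exact: recursive_const.
- by apply: (r2 (fun t => den t - 1)%N); exact: recursive_sub rden (recursive_const _ 1).
- move=> t k; rewrite string_codeK muE /= subr0 subn1 prednK//.
  rewrite /prefix_prod /num /den !natr_prod -prodf_div subrr normr0.
  by rewrite exprn_ge0.
Qed.

Lemma cond_prob_weights Q mu t b : recursive_weights Q ->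
  (forall t, mu (cylinder t) = (prefix_prod (rat_prob R Q) t)%:E) ->
  cond_prob mu t b = rat_prob R Q t b.
Proof.
move=> rQ muE; rewrite /cond_prob !muE /= prefix_prod_rcons mulrC mulKf// gt_eqF//.
by apply: prefix_prod_gt0 => *; exact: rat_prob_gt0.
Qed.

Lemma cond_prob_le1 nu t b : full_support nu -> cond_prob nu t b <= 1.
Proof.
move=> fs; have := cond_probD t fs.
have := cond_prob_gt0 t false fs; have := cond_prob_gt0 t true fs.
by case: b; lra.
Qed.

(* Splitting a level of a [mu]-test into the strings without late entries and the
   others, a level of index about [3 n] has [nu]-measure at most [2 ^ - n]. *)
Lemma MLR_dominated_entries nu mu (s : nat -> nat -> seq bool) :
  (forall j, nu (\bigcup_m cylinder (s j m)) <= (2^-1 ^+ j)%:E)%E ->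
  (forall n t, (forall j i, (n <= j)%N -> ~~ entry s j (take i t)) ->
     nu (cylinder t) <= (2 * 4 ^+ n)%:E * mu (cylinder t))%E ->
  MLR_dominated nu mu.
Proof.
move=> nus numu w nuw V [v [rec_v VE]] muV wV.
apply: (nuw (fun n => V (3 * n + 6)%N)).
- exists (fun n m => v (3 * n + 6)%N m); split => [|n]; last exact: VE.
  apply: (recursive_comp2 rec_v (recursive_add (recursive_mul (recursive_const _ 3)
    recursive_fst) (recursive_const _ 6)) recursive_snd).
- move=> n; set k := (3 * n + 6)%N.
  pose good t := forall j i, (n.+2 <= j)%N -> ~~ entry s j (take i t).
  pose B := [set t | good t /\ exists m, v k m = t].
  pose Y := \bigcup_j \bigcup_m cylinder (s (n.+2 + j)%N m).
  have mB : measurable (\bigcup_(t in B) cylinder t) by exact: measurable_bigcup_cylinder.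
  have mV : measurable (V k) by rewrite VE; exact: measurable_bigcup_cylinder.
  have mY : measurable Y.
    by apply: bigcup_measurable => j _; exact: measurable_bigcup_cylinder.
  have sub : V k `<=` (\bigcup_(t in B) cylinder t) `|` Y.
    move=> x; rewrite VE => -[m _ xm].
    have [gm|/existsNP [j /existsNP [i /not_implyP [nj /negP]]]] := pselect (good (v k m)).
      by left; exists (v k m) => //; split => //; exists m.
    rewrite negbK => /andP[/andP[_ /existsP[l lm]] _]; right.
    exists (j - n.+2)%N => //; rewrite subnKC//; exists (val l) => //.
    apply: sub_cylinder xm; apply: prefix_trans lm _.
    by rewrite -{2}(cat_take_drop i (v k m)) prefix_prefix.
  have BV : \bigcup_(t in B) cylinder t `<=` V k.
    by rewrite VE => x [t [_ [m <-]] xt]; exists m.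
  have nuB : (nu (\bigcup_(t in B) cylinder t) <= (2^-1 ^+ n.+1)%:E)%E.
    have K0 : 0 <= 2 * 4 ^+ n.+2 :> R by rewrite mulr_ge0 ?exprn_ge0.
    apply: le_trans (measure_cylinders_le (mu := mu) K0 _) _.
      by move=> t [gt _]; exact: numu.
    apply: (@le_trans _ _ ((2 * 4 ^+ n.+2)%:E * (2^-1 ^+ k)%:E)%E).
      rewrite lee_wpmul2l ?lee_fin//; apply: le_trans (muV k).
      by apply: le_measure; rewrite ?inE.
    rewrite -EFinM lee_fin /k.
    have -> : 4 ^+ n.+2 = 2 ^+ (2 * n.+2) :> R.
      by rewrite exprM; congr (_ ^+ _); rewrite expr2 -natrM.
    rewrite -exprS !exprVn ler_pdivrMr ?exprn_gt0// ler_pdivlMl ?exprn_gt0//.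
    by rewrite -exprD ler_eXn2l ?ltr1n//; lia.
  have nuY : (nu Y <= (2^-1 ^+ n.+1)%:E)%E.
    have mF j : measurable (\bigcup_m cylinder (s (n.+2 + j)%N m)).
      exact: measurable_bigcup_cylinder.
    apply: le_trans (measure_sigma_subadditive nu mF mY (@subset_refl _ _)) _.
    have e0 : 0 <= 2^-1 ^+ n.+1 :> R by rewrite exprn_ge0.
    apply: le_trans (epsilon_trick0 xpredT e0).
    apply: lee_nneseries => j _; first by rewrite measure_ge0.
    apply: le_trans (nus _) _; rewrite lee_fin natrX !exprVn -invfM -exprD.
    by rewrite addSnnS.
  apply: (@le_trans _ _ (nu ((\bigcup_(t in B) cylinder t) `|` Y))).
    by apply: le_measure; rewrite ?inE//; exact: measurableU.
  apply: le_trans (measureU2 _ _ _) _ => //.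
  apply: (le_trans (leeD nuB nuY)).
  by rewrite -EFinD lee_fin exprS; lra.
- by move=> n _; exact: wV.
Qed.

(* No single value is far from every conditional probability of [nu]: the
   conditional probability of [true] is moved to 1/4 in one measure and to 3/4
   in the other. *)
Definition biased_weights P (s : nat -> nat -> seq bool) (e : bool) t b :=
  if entries s t then (if b == e then 3 else 1)%N else P t b.

Lemma recursive_biased_weights P s e : recursive2 (fun n m => string_code (s n m)) ->
  recursive_weights P -> recursive_weights (biased_weights P s e).
Proof.
move=> rs [rP P0]; split=> [b|t b]; last first.
  by rewrite /biased_weights; case: ifP => // _; case: ifP.
exact: recursive_if (recursive_entries rs) (recursive_const _ _) (rP b).
Qed.

Lemma biased_weights_le nu mu P s e n t : full_support nu ->
  recursive2 (fun n m => string_code (s n m)) ->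
  recursive_weights P -> approximates P nu ->
  (forall t, mu (cylinder t) = (prefix_prod (rat_prob R (biased_weights P s e)) t)%:E) ->
  (forall j i, (n <= j)%N -> ~~ entry s j (take i t)) ->
  (nu (cylinder t) <= (2 * 4 ^+ n)%:E * mu (cylinder t))%E.
Proof.
move=> fs rs rP Pnu muE tn.
have rQ := recursive_biased_weights e rs rP.
set q := rat_prob R (biased_weights P s e).
pose c (t' : seq bool) (b : bool) : R := if entries s t' then 4 else 1.
have c0 t' b : 0 <= c t' b by rewrite /c; case: ifP.
have q0 t' b : 0 <= q t' b by rewrite ltW// rat_prob_gt0.
rewrite muE -(fineK (cylinder_fin_num nu t)) -EFinM lee_fin cond_prob_prod//.
apply: (@le_trans _ _ (2 * prefix_prod (fun t b => c t b * q t b) t)).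
  apply: prefix_prod_delta => t' b; first by rewrite mulr_ge0.
  rewrite ltW ?cond_prob_gt0//= /c /q /rat_prob /biased_weights.
  case: ifP => et; last by rewrite mul1r; exact: (Pnu t' b).1.
  have d0 := ltW (delta_gt0 R (size t')).
  apply: (le_trans (cond_prob_le1 t' b fs)); rewrite -[leLHS]mulr1.
  apply: ler_pM => //; first by rewrite lerDl.
  rewrite mulrA ler_pdivlMr ?ltr0n; last by case: e {rQ q q0 muE}.
  by rewrite mul1r -natrM ler_nat; case: b; case: e {rQ q q0 muE}.
rewrite prefix_prodM -/q mulrA ler_wpM2r//; first exact: prefix_prod_ge0.
by rewrite ler_wpM2l//; exact: prod_entries_le.
Qed.

Lemma hellinger_biased nu P s w n (mu : bool -> probability cantor R) :
  full_support nu -> (forall e, full_support (mu e)) ->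
  recursive2 (fun n m => string_code (s n m)) -> recursive_weights P ->
  (forall e t, mu e (cylinder t) = (prefix_prod (rat_prob R (biased_weights P s e)) t)%:E) ->
  entries s (mkseq w n) ->
  32^-1 <= hellingerF n nu (mu false) w ^+ 2 + hellingerF n nu (mu true) w ^+ 2.
Proof.
move=> fs fsm rs rP muE ent.
have lower e : (cond_prob nu (mkseq w n) true - (if e then 3 else 1) / 4) ^+ 2 / 4 <=
    hellingerF n nu (mu e) w ^+ 2.
  rewrite hellingerF_sqr//; set t := mkseq w n.
  rewrite -/(affinity (cond_prob nu t) (cond_prob (mu e) t)).
  rewrite affinityE ?cond_probD// => [|b|b]; try by rewrite ltW ?cond_prob_gt0.
  have -> : (if e then 3 else 1) / 4 = cond_prob (mu e) t true.
    rewrite (cond_prob_weights _ _ (recursive_biased_weights e rs rP) (muE e)).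
    by rewrite /rat_prob /biased_weights ent; case: (e).
  have /andP[h _] := sqr_sqrt_sub_bounds (cond_prob_gt0 t true fs) (cond_prob_gt0 t true (fsm e)).
  have := sqr_ge0 (Num.sqrt (cond_prob nu t false) - Num.sqrt (cond_prob (mu e) t false)).
  suff : (cond_prob nu t true - cond_prob (mu e) t true) ^+ 2 / 4 <=
     (cond_prob nu t true - cond_prob (mu e) t true) ^+ 2 /
     (2 * (cond_prob nu t true + cond_prob (mu e) t true)) by lra.
  rewrite ler_wpM2l ?sqr_ge0// lef_pV2 ?posrE ?mulr_gt0 ?addr_gt0 ?cond_prob_gt0//.
  by have := cond_prob_le1 t true fs; have := cond_prob_le1 t true (fsm e); lra.
have := lower false; have := lower true.
set p := cond_prob _ _ _; have := sqr_ge0 (p - 2^-1); rewrite !expr2 => ???.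
by lra.
Qed.

Lemma MR2_sub_MLR nu : computable_measure nu -> full_support nu ->
  MR2 nu `<=` MLR nu.
Proof.
move=> cnu fnu w wMR U [s [rs UE]] nuU wU.
have [P [rP Pnu]] := exists_approximation cnu fnu.
have /choice [mu muP] : forall e, exists mu : probability cantor R,
  [/\ computable_measure mu, full_support mu &
      forall t, mu (cylinder t) = (prefix_prod (rat_prob R (biased_weights P s e)) t)%:E].
  by move=> e; apply: weights_measure; exact: recursive_biased_weights.
have numu e : MLR_dominated nu (mu e).
  have [_ _ muE] := muP e.
  apply: (@MLR_dominated_entries _ _ s) => [j|n t tn]; first by rewrite -UE.
  exact: biased_weights_le muE tn.
have fmu e : full_support (mu e) by have [] := muP e.
pose a e n := hellingerF n nu (mu e) w ^+ 2.
have a0 e n : 0 <= a e n by rewrite sqr_ge0.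
have fin e : (\sum_(0 <= n <oo) (a e n)%:E < +oo)%E.
  by have [cmu _ _] := muP e; exact: wMR.
have grow K : exists N, K%:R / 32 <= \sum_(n < N) (a false n + a true n).
  elim: K => [|K [N IH]]; first by exists 0%N; rewrite big_ord0 mul0r.
  have wN : (\bigcup_m cylinder (s N m)) w by rewrite -UE; exact: wU.
  have [n [Nn ent]] := exists_entry wN; exists n.+1.
  rewrite big_ord_recr /= -natr1 mulrDl mul1r lerD//; last first.
    by apply: (hellinger_biased (P := P) fnu fmu rs) ent => // e; have [] := muP e.
  apply: (le_trans IH); rewrite -!(big_mkord xpredT (fun n => a false n + a true n)).
  by rewrite [leRHS](big_cat_nat _ Nn)//= lerDl sumr_ge0// => i _; rewrite addr_ge0.
have bound e : exists M, forall N, \sum_(n < N) a e n <= M.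
  have h0 : (0 <= \sum_(0 <= n <oo) (a e n)%:E)%E.
    by apply: nneseries_ge0 => n _ _; rewrite lee_fin.
  exists (fine (\sum_(0 <= n <oo) (a e n)%:E)) => N.
  rewrite -lee_fin fineK ?ge0_fin_numE// -sumEFin -(big_mkord xpredT (fun n => (a e n)%:E)).
  by apply: nneseries_lim_ge => n _; rewrite lee_fin.
have [M0 h0] := bound false; have [M1 h1] := bound true.
have [N] := grow (Num.truncn (32 * (M0 + M1))).+1.
rewrite big_split /= leNgt => /negP; apply.
apply: le_lt_trans (lerD (h0 N) (h1 N)) _.
rewrite ltr_pdivlMr// mulrC; exact: truncnS_gt.
Qed.

End nonrandom.

Theorem corollary1p18 (R : realType) (nu : probability cantor R)
    (nu_computable : computable_measure nu) (nu_full_support : full_support nu) :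
  MLR nu = MR2 nu.
Proof.
by apply/seteqP; split; [exact: MLR_sub_MR2|exact: MR2_sub_MLR].
Qed.
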